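(* Let $V'$ be an immediate extension of a valuation ring $V$, $K\subset K'$ their fraction field extension, $v=(v_j)_{j<\lambda}$ a pseudo-convergent sequence in $V$ which is not fundamental and has a pseudo limit $x$ in $V'$, but having no pseudo limit in $K$, and suppose $K'=K(x)$. Assume $x$ is transcendental over $K$ and either $\dim V=1$, or $V$ is Henselian. Then the following statements are equivalent: \begin{enumerate} \item for every polynomial $f\in V[X]$ with $f(x)\not =0$ there exists a $y\in V$ such that $\mathrm{val}(f(y))= \mathrm{val}(f(x))$, \item for every polynomial $f\in V[X]$ with $f(x)\not =0$ there exists a $y\in V$ such that $\mathrm{val}(f(y))\geq \mathrm{val}(f(x))$, \item $v$ is transcendental, \item $V'$ is a filtered union of its localizations of polynomial $V$-subalgebras in one variable. \end{enumerate}
   Context: $\mathrm{val}$ is the valuation with value group $\Gamma$. $v$ is pseudo convergent if $\mathrm{val}(v_i-v_{i''})<\mathrm{val}(v_{i'}-v_{i''})$ for $i<i'<i''<\lambda$; $x$ is a pseudo limit if $\mathrm{val}(x-v_i)=\mathrm{val}(v_i-v_{i'})$ for $i<i'<\lambda$; $v$ is fundamental if for every $\gamma\in\Gamma$, $\mathrm{val}(v_i-v_{i'})>\gamma$ for large $i<i'<\lambda$; $v$ is transcendental if each $f\in V[T]$ satisfies $\mathrm{val}(f(v_i))=\mathrm{val}(f(v_{i'}))$ for large enough $i<i'<\lambda$. *)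

(* Defs.v *)
From HB Require Import structures.
From mathcomp Require Import all_boot all_order all_algebra.
Set Implicit Arguments. Unset Strict Implicit. Unset Printing Implicit Defensive.
Import Order.TTheory GRing.Theory Num.Theory.
Local Open Scope ring_scope.

Section Defs.
Variable L : fieldType.

Definition is_subring (A : L -> Prop) : Prop :=
  A 1 /\ (forall a b, A a -> A b -> A (a - b)) /\ (forall a b, A a -> A b -> A (a * b)).

Definition is_subfield (K : L -> Prop) : Prop :=
  is_subring K /\ (forall a, K a -> K a^-1).

Definition is_valuation_ring_of (K V : L -> Prop) : Prop :=
  is_subring V /\ (forall a, V a -> K a) /\
  (forall a, K a -> a != 0 -> V a \/ V a^-1).

(* The valuation of the valuation ring R, given intrinsically by divisibility:
   vle R a b  <->  val a <= val b   (val 0 = infinity). *)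
Definition vle (R : L -> Prop) (a b : L) : Prop := b = 0 \/ (a != 0 /\ R (b / a)).
Definition vlt (R : L -> Prop) (a b : L) : Prop := vle R a b /\ ~ vle R b a.
Definition veq (R : L -> Prop) (a b : L) : Prop := vle R a b /\ vle R b a.

Definition maxid (R : L -> Prop) (a : L) : Prop := R a /\ (a = 0 \/ ~ R a^-1).

(* V' (valuation ring of L) is an immediate extension of V (valuation ring of K):
   V = V' ∩ K, same value group, same residue field. *)
Definition immediate_extension (K V V' : L -> Prop) : Prop :=
  (forall a, K a -> (V a <-> V' a)) /\
  (forall a, a != 0 -> exists b, K b /\ b != 0 /\ veq V' a b) /\
  (forall a, V' a -> exists b, V b /\ maxid V' (a - b)).

Definition poly_over (A : L -> Prop) (f : {poly L}) : Prop := forall i, A f`_i.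

Definition generated_by (K : L -> Prop) (x : L) : Prop :=
  forall a, exists p q : {poly L}, poly_over K p /\ poly_over K q /\
    q.[x] != 0 /\ a = p.[x] / q.[x].

Definition transcendental_over (K : L -> Prop) (x : L) : Prop :=
  forall p : {poly L}, poly_over K p -> p != 0 -> p.[x] != 0.

Definition is_prime_ideal (V P : L -> Prop) : Prop :=
  (forall a, P a -> V a) /\ P 0 /\ (forall a b, P a -> P b -> P (a + b)) /\
  (forall a b, V a -> P b -> P (a * b)) /\ ~ P 1 /\
  (forall a b, V a -> V b -> P (a * b) -> P a \/ P b).

Definition strict_subset (P Q : L -> Prop) : Prop :=
  (forall a, P a -> Q a) /\ exists a, Q a /\ ~ P a.

Definition krull_dim_one (V : L -> Prop) : Prop :=
  (exists P Q, is_prime_ideal V P /\ is_prime_ideal V Q /\ strict_subset P Q) /\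
  ~ (exists P Q R, is_prime_ideal V P /\ is_prime_ideal V Q /\ is_prime_ideal V R /\
       strict_subset P Q /\ strict_subset Q R).

Definition henselian (V : L -> Prop) : Prop :=
  forall f : {poly L}, poly_over V f -> f \is monic ->
  forall a, V a -> maxid V f.[a] -> ~ maxid V (f^`()).[a] ->
  exists b, V b /\ f.[b] = 0 /\ maxid V (b - a).

(* Sequences indexed by a well-ordered set without largest element
   (i.e. a nonzero limit ordinal lambda). *)
Section Seq.
Variables (d : Order.disp_t) (I : orderType d).

Definition pseudo_convergent (V : L -> Prop) (v : I -> L) : Prop :=
  forall i i' i'', (i < i')%O -> (i' < i'')%O -> vlt V (v i - v i'') (v i' - v i'').

Definition pseudo_limit (R : L -> Prop) (v : I -> L) (x : L) : Prop :=
  forall i i', (i < i')%O -> veq R (x - v i) (v i - v i').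

(* gamma ranges over the value group = valuations of nonzero elements of K *)
Definition fundamental (K V : L -> Prop) (v : I -> L) : Prop :=
  forall c, K c -> c != 0 -> exists i0, forall i i', (i0 <= i)%O -> (i < i')%O ->
    vlt V c (v i - v i').

Definition transcendental_seq (V : L -> Prop) (v : I -> L) : Prop :=
  forall f : {poly L}, poly_over V f -> exists i0, forall i i', (i0 <= i)%O -> (i < i')%O ->
    veq V f.[v i] f.[v i'].
End Seq.

(* Localization of the polynomial V-subalgebra V[z] of V' at the prime m' ∩ V[z]. *)
Definition loc_poly_subalg (V V' : L -> Prop) (z : L) (a : L) : Prop :=
  exists p q : {poly L}, poly_over V p /\ poly_over V q /\
    V' q.[z] /\ ~ maxid V' q.[z] /\ a = p.[z] / q.[z].

(* V' is a filtered union of its localizations of polynomial V-subalgebras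
   V[z] ≅ V[X] (z in V', no nonzero polynomial over V vanishes at z). *)
Definition filtered_union_loc_poly (V V' : L -> Prop) : Prop :=
  exists (J : Type) (z : J -> L),
    (forall j, V' (z j)) /\
    (forall j p, poly_over V p -> p != 0 -> p.[z j] != 0) /\
    (exists j : J, True) /\
    (forall j k, exists l, (forall a, loc_poly_subalg V V' (z j) a -> loc_poly_subalg V V' (z l) a) /\
                           (forall a, loc_poly_subalg V V' (z k) a -> loc_poly_subalg V V' (z l) a)) /\
    (forall a, V' a <-> exists j, loc_poly_subalg V V' (z j) a).
End Defs.

(* Main.v *)
Require Import Defs.
From HB Require Import structures.
From mathcomp Require Import all_boot all_order all_algebra all_fingroup all_field.
From mathcomp Require Import boolp.
From mathcomp Require classical_sets.
From mathcomp Require Import mpoly.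
Import Order.TTheory GRing.Theory Num.Theory.
Set Implicit Arguments. Unset Strict Implicit. Unset Printing Implicit Defensive.
Local Open Scope ring_scope.

(* (1) => (2) is trivial.  Over a valued extension splitting a given polynomial, the value of
   f(v_i) = lc * prod (v_i - a) is eventually constant unless some root a is itself a pseudo
   limit of v, in which case it is eventually strictly increasing.  Hence for transcendental v
   the rescaled Taylor expansion of f at v_i is eventually dominated by its constant term,
   which yields (1) and, with z = (x - v_i) / (v_i' - v_i), also (4).  For (4) => (1), reduce
   z modulo the maximal ideal to retract the localization of V[z] onto V.

   For (2) => (3), let F be K if V is Henselian and the closure of K in the splitting field if
   dim V = 1; F contains no pseudo limit because v is not fundamental.  Let q be a monic
   polynomial over F of least degree having a pseudo limit as a root.  If y in F had
   val q(y) >= val q(v_i) for large i, then the set S of the roots a with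
   val (y - a) <= val (y - v_i) would be proper and nonempty.  For t of larger value than
   y - v_i, the product of y + t - a over S has the strictly smallest value among all products
   over sets of |S| roots; so, after scaling, it is a simple root modulo the maximal ideal of
   the polynomial whose roots are all these products, and it lies in F by Hensel's lemma (or,
   in rank one, as a limit of ratios of power sums).  Interpolating in t puts
   prod_(a in S) (X - a) over F, against minimality.  So q (or a close approximation of it
   over K) contradicts (2). *)

(** * Subrings and valuations *)

Section Subring.
Variables (L : fieldType) (A : L -> Prop).
Hypothesis hA : is_subring A.

Lemma subring1 : A 1. Proof. by case: hA. Qed.
Lemma subringB a b : A a -> A b -> A (a - b). Proof. by case: hA => _ [h _]; exact: h. Qed.
Lemma subringM a b : A a -> A b -> A (a * b). Proof. by case: hA => _ [_ h]; exact: h. Qed.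
Lemma subring0 : A 0. Proof. by rewrite -(subrr (1 : L)); apply: subringB; exact: subring1. Qed.
Lemma subringN a : A a -> A (- a).
Proof. by rewrite -sub0r; apply: subringB; exact: subring0. Qed.
Lemma subringD a b : A a -> A b -> A (a + b).
Proof. by move=> ha hb; rewrite -(opprK b); apply: subringB => //; exact: subringN. Qed.
Lemma subringX a n : A a -> A (a ^+ n).
Proof.
move=> ha; elim: n => [|n ih]; first by rewrite expr0; exact: subring1.
by rewrite exprS; exact: subringM.
Qed.
Lemma subring_nat n : A n%:R.
Proof. by elim: n => [|n ih]; [exact: subring0 | rewrite -natr1; apply: subringD => //; exact: subring1]. Qed.
Lemma subring_int (z : int) : A z%:~R.
Proof. by case: z => n; rewrite ?NegzE ?mulrNz; try apply: subringN; exact: subring_nat. Qed.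
Lemma subring_sum (T : Type) (r : seq T) (P : pred T) F :
  (forall i, P i -> A (F i)) -> A (\sum_(i <- r | P i) F i).
Proof. by move=> h; apply: (big_ind A) => //; [exact: subring0 | exact: subringD]. Qed.
Lemma subring_prod (T : Type) (r : seq T) (P : pred T) F :
  (forall i, P i -> A (F i)) -> A (\prod_(i <- r | P i) F i).
Proof. by move=> h; apply: (big_ind A) => //; [exact: subring1 | exact: subringM]. Qed.

Lemma poly_over0 : poly_over A 0. Proof. by move=> i; rewrite coef0; exact: subring0. Qed.
Lemma poly_overC c : A c -> poly_over A c%:P.
Proof. by move=> hc i; rewrite coefC; case: eqP => // _; exact: subring0. Qed.
Lemma poly_overX : poly_over A 'X.
Proof. by move=> i; rewrite coefX; case: eqP => // _; [exact: subring1 | exact: subring0]. Qed.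
Lemma poly_overD p q : poly_over A p -> poly_over A q -> poly_over A (p + q).
Proof. by move=> hp hq i; rewrite coefD; exact: subringD. Qed.
Lemma poly_overB p q : poly_over A p -> poly_over A q -> poly_over A (p - q).
Proof. by move=> hp hq i; rewrite coefB; exact: subringB. Qed.
Lemma poly_overM p q : poly_over A p -> poly_over A q -> poly_over A (p * q).
Proof. by move=> hp hq i; rewrite coefM; apply: subring_sum => j _; exact: subringM. Qed.
Lemma poly_overZ c p : A c -> poly_over A p -> poly_over A (c *: p).
Proof. by move=> hc hp i; rewrite coefZ; exact: subringM. Qed.
Lemma poly_over_exp p n : poly_over A p -> poly_over A (p ^+ n).
Proof.
move=> hp; elim: n => [|n ih]; first by rewrite expr0; apply: poly_overC; exact: subring1.
by rewrite exprS; exact: poly_overM.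
Qed.
Lemma poly_over_sum (T : Type) (r : seq T) (P : pred T) F :
  (forall i, P i -> poly_over A (F i)) -> poly_over A (\sum_(i <- r | P i) F i).
Proof.
by move=> h; apply: (big_ind (poly_over A)) => //; [exact: poly_over0 | exact: poly_overD].
Qed.
Lemma poly_over_prod (T : Type) (r : seq T) (P : pred T) F :
  (forall i, P i -> poly_over A (F i)) -> poly_over A (\prod_(i <- r | P i) F i).
Proof.
move=> h; apply: (big_ind (poly_over A)) => //; last exact: poly_overM.
by apply: poly_overC; exact: subring1.
Qed.
Lemma poly_over_comp p q : poly_over A p -> poly_over A q -> poly_over A (p \Po q).
Proof.
move=> hp hq; rewrite comp_polyE; apply: poly_over_sum => i _.
by apply: poly_overZ => //; exact: poly_over_exp.
Qed.
Lemma poly_over_horner p a : poly_over A p -> A a -> A p.[a].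
Proof.
move=> hp ha; rewrite horner_coef; apply: subring_sum => i _.
by apply: subringM => //; exact: subringX.
Qed.
Lemma poly_over_deriv p : poly_over A p -> poly_over A p^`().
Proof. by move=> hp i; rewrite coef_deriv -mulr_natr; apply: subringM => //; exact: subring_nat. Qed.
Lemma poly_over_prodXsub (s : seq L) : (forall a, a \in s -> A a) ->
  poly_over A (\prod_(a <- s) ('X - a%:P)).
Proof.
move=> h; rewrite big_seq; apply: poly_over_prod => a /h ha.
by apply: poly_overB; [exact: poly_overX | exact: poly_overC].
Qed.
End Subring.

Section Valuation.
Variables (L : fieldType) (W : L -> Prop).
Hypothesis hW : is_valuation_ring_of (fun _ => True) W.
Let hR : is_subring W. Proof. by case: hW. Qed.
Local Notation "a <~ b" := (vle W a b) (at level 70).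
(** By totality of [vle W], the negation alone is equivalent to [vlt W a b]. *)
Local Notation "a <! b" := (~ vle W b a) (at level 70).

Lemma vleE a b : a != 0 -> (a <~ b) <-> W (b / a).
Proof.
move=> na; split=> [[->|[] _ //]|h]; last by right.
by rewrite mul0r; exact: (subring0 hR).
Qed.
Lemma vle_x0 a : a <~ 0. Proof. by left. Qed.
Lemma vle_0x b : 0 <~ b -> b = 0. Proof. by case=> // -[]; rewrite eqxx. Qed.
Lemma vle_refl a : a <~ a.
Proof. by have [->|na] := eqVneq a 0; [left | apply/vleE => //; rewrite divff //; exact: (subring1 hR)]. Qed.
Lemma vle_trans b a c : a <~ b -> b <~ c -> a <~ c.
Proof.
move=> hab [->|[nb hbc]]; first exact: vle_x0.
case: hab => [b0|[na hab]]; first by rewrite b0 eqxx in nb.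
by apply/vleE => //; rewrite -(mulfVK nb c) -(mulrA (c / b)); exact: (subringM hR).
Qed.
Lemma vle_total a b : a <~ b \/ b <~ a.
Proof.
have [->|na] := eqVneq a 0; first by right; left.
have [->|nb] := eqVneq b 0; first by left; left.
have nz : b / a != 0 by rewrite mulf_neq0 ?invr_eq0.
have [h|h] := hW.2.2 _ I nz; [left|right]; apply/vleE => //.
by rewrite invf_div in h.
Qed.
Lemma vltW a b : a <! b -> a <~ b. Proof. by case: (vle_total a b). Qed.
Lemma vlt_neq0 a b : a <! b -> a != 0.
Proof. by move=> h; apply/eqP => a0; apply: h; rewrite a0; exact: vle_x0. Qed.
Lemma vle_lt_trans b a c : a <~ b -> b <! c -> a <! c.
Proof. by move=> hab hbc hca; apply: hbc; exact: vle_trans hab. Qed.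
Lemma vlt_le_trans b a c : a <! b -> b <~ c -> a <! c.
Proof. by move=> hab hbc hca; apply: hab; exact: vle_trans hca. Qed.
Lemma vle_mul a b c d : a <~ b -> c <~ d -> a * c <~ b * d.
Proof.
move=> [->|[na hab]] [->|[nc hcd]]; rewrite ?mul0r ?mulr0; try exact: vle_x0.
apply/vleE; first by rewrite mulf_neq0.
by rewrite invfM mulrACA; exact: (subringM hR).
Qed.
Lemma vle_pmul2r c a b : c != 0 -> (a * c <~ b * c) <-> (a <~ b).
Proof.
move=> nc; split=> h; last by apply: vle_mul => //; exact: vle_refl.
by rewrite -(mulfK nc a) -(mulfK nc b); apply: vle_mul => //; exact: vle_refl.
Qed.
Lemma vle_pmul2l c a b : c != 0 -> (c * a <~ c * b) <-> (a <~ b).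
Proof. by rewrite ![c * _]mulrC; exact: vle_pmul2r. Qed.
Lemma vlt_mul a b c d : a <! b -> c <~ d -> c != 0 -> a * c <! b * d.
Proof.
move=> hab hcd nc h; apply: hab; apply/(vle_pmul2r _ _ nc).
by apply: vle_trans h; apply: vle_mul => //; exact: vle_refl.
Qed.
Lemma vle_add a b c : c <~ a -> c <~ b -> c <~ a + b.
Proof.
have [->|nc] := eqVneq c 0; first by move=> /vle_0x -> /vle_0x ->; rewrite addr0; left.
by move=> /(vleE _ nc) ha /(vleE _ nc) hb; apply/vleE => //; rewrite mulrDl; exact: (subringD hR).
Qed.
Lemma vleN1 a : a <~ - a.
Proof.
have [->|na] := eqVneq a 0; first by rewrite oppr0; left.
by apply/vleE => //; rewrite mulNr divff //; apply: (subringN hR) => //; exact: (subring1 hR).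
Qed.
Lemma vle_oppr a b : a <~ b -> a <~ - b.
Proof. by move=> h; apply: vle_trans (vleN1 b). Qed.
Lemma vle_sub a b c : c <~ a -> c <~ b -> c <~ a - b.
Proof. by move=> ha /vle_oppr; exact: vle_add. Qed.
Lemma vle_subC a b c : c <~ a - b -> c <~ b - a.
Proof. by move/vle_oppr; rewrite opprB. Qed.
Lemma vlt_oppr a b : a <! b -> a <! - b.
Proof. by move=> h h2; apply: h; apply: vle_trans h2; exact: vleN1. Qed.
Lemma vlt_add a b c : c <! a -> c <! b -> c <! a + b.
Proof.
move=> ha hb; case: (vle_total a b) => h.
  by apply: (vlt_le_trans ha); apply: vle_add => //; exact: vle_refl.
by apply: (vlt_le_trans hb); apply: vle_add => //; exact: vle_refl.
Qed.
Lemma vlt_sub a b c : c <! a -> c <! b -> c <! a - b.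
Proof. by move=> ha /vlt_oppr; exact: vlt_add. Qed.
Lemma vle_sum (T : Type) (r : seq T) (P : pred T) F c :
  (forall i, P i -> c <~ F i) -> c <~ \sum_(i <- r | P i) F i.
Proof. by move=> h; apply: (big_ind (vle W c)); [exact: vle_x0 | move=> a b; exact: vle_add | exact: h]. Qed.
Lemma vlt_sum (T : Type) (r : seq T) (P : pred T) F c : c != 0 ->
  (forall i, P i -> c <! F i) -> c <! \sum_(i <- r | P i) F i.
Proof.
move=> nc h; apply: (big_ind (fun a => c <! a)) => //; last by move=> a b; exact: vlt_add.
by move=> /vle_0x c0; rewrite c0 eqxx in nc.
Qed.

Lemma veq_refl a : veq W a a. Proof. by split; exact: vle_refl. Qed.
Lemma veq_sym a b : veq W a b -> veq W b a. Proof. by case. Qed.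
Lemma veq_trans b a c : veq W a b -> veq W b c -> veq W a c.
Proof. by move=> [h1 h2] [h3 h4]; split; exact: (@vle_trans b). Qed.
Lemma veq_mul a b c d : veq W a b -> veq W c d -> veq W (a * c) (b * d).
Proof. by move=> [? ?] [? ?]; split; exact: vle_mul. Qed.
Lemma veq_opp a : veq W a (- a).
Proof. by split; [exact: vleN1 | rewrite -{2}(opprK a); exact: vleN1]. Qed.
Lemma veq_subC a b : veq W (a - b) (b - a).
Proof. by rewrite -(opprB a b); exact: veq_opp. Qed.
(** If [a + b] had value above that of [a], so would [a = (a + b) - b]. *)
Lemma veq_addr a b : a <! b -> veq W a (a + b).
Proof.
move=> h; split; first by apply: vle_add; [exact: vle_refl | exact: vltW].
case: (vle_total (a + b) a) => // h2; apply: contrapT => h3.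
have := vlt_sub h3 h; rewrite addrK; apply; exact: vle_refl.
Qed.
Lemma veq_subr a b : a <! b -> veq W a (a - b).
Proof. by move=> /vlt_oppr; exact: veq_addr. Qed.
Lemma veq_eq0 a b : veq W a b -> (a == 0) = (b == 0).
Proof.
move=> [h1 h2]; apply/idP/idP => /eqP e; move: h1 h2; rewrite e.
  by move=> /vle_0x ->.
by move=> _ /vle_0x ->.
Qed.
Lemma veq_exp a b n : veq W a b -> veq W (a ^+ n) (b ^+ n).
Proof.
move=> h; elim: n => [|n ih]; first by rewrite !expr0; exact: veq_refl.
by rewrite !exprS; exact: veq_mul.
Qed.
Lemma vle_exp a b n : a <~ b -> a ^+ n <~ b ^+ n.
Proof.
move=> h; elim: n => [|n ih]; first by rewrite !expr0; exact: vle_refl.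
by rewrite !exprS; exact: vle_mul.
Qed.

Lemma vring_ge1 a : W a <-> 1 <~ a.
Proof. by rewrite vleE ?oner_neq0 // divr1. Qed.
Lemma maxidE a : maxid W a <-> 1 <! a.
Proof.
split=> [[ha [->|h]]|h].
- by move=> /vle_0x /eqP; rewrite oner_eq0.
- by move=> [/eqP|[na]]; rewrite ?oner_eq0 // div1r.
split; first by apply/vring_ge1; exact: vltW.
have [->|na] := eqVneq a 0; [by left | right => h2; apply: h].
by apply/vleE => //; rewrite div1r.
Qed.
Lemma vunitE a : (W a /\ ~ maxid W a) <-> veq W 1 a.
Proof.
rewrite maxidE vring_ge1; split=> [[h1 h2]|[h1 h2]]; split => //.
exact: contrapT.
Qed.
Lemma vle_div a b c : c != 0 -> (a <~ b / c) <-> (a * c <~ b).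
Proof. by move=> nc; rewrite -(vle_pmul2r _ _ nc) mulfVK. Qed.
Lemma vle_divl a b c : c != 0 -> (a / c <~ b) <-> (a <~ b * c).
Proof. by move=> nc; rewrite -(vle_pmul2r _ _ nc) mulfVK. Qed.

Lemma vle_prod (T : eqType) (r : seq T) (P : pred T) F G :
  (forall i, i \in r -> P i -> F i <~ G i) ->
  \prod_(i <- r | P i) F i <~ \prod_(i <- r | P i) G i.
Proof.
elim: r => [|i r ih] h; first by rewrite !big_nil; exact: vle_refl.
have {}ih : \prod_(i <- r | P i) F i <~ \prod_(i <- r | P i) G i.
  by apply: ih => j hj; apply: h; rewrite inE hj orbT.
rewrite !big_cons; case: ifP => // hi; apply: vle_mul => //.
by apply: h => //; rewrite inE eqxx.
Qed.
Lemma vlt_prod (T : eqType) (r : seq T) (P : pred T) F G i0 :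
  (forall i, i \in r -> P i -> F i != 0 /\ F i <~ G i) ->
  i0 \in r -> P i0 -> F i0 <! G i0 ->
  \prod_(i <- r | P i) F i <! \prod_(i <- r | P i) G i.
Proof.
move=> h hi0 Pi0 hlt.
rewrite !(perm_big _ (perm_to_rem hi0)) !big_cons Pi0; apply: vlt_mul => //.
  by apply: vle_prod => i hi Pi; case: (h i _ Pi) => //; exact: mem_rem hi.
rewrite prodf_seq_neq0; apply/allP => i hi; apply/implyP => Pi.
by case: (h i _ Pi) => //; exact: mem_rem hi.
Qed.
Lemma veq_prod (T : eqType) (r : seq T) (P : pred T) F G :
  (forall i, i \in r -> P i -> veq W (F i) (G i)) ->
  veq W (\prod_(i <- r | P i) F i) (\prod_(i <- r | P i) G i).
Proof. by move=> h; split; apply: vle_prod => i hi Pi; case: (h i hi Pi). Qed.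
End Valuation.

(** * Extending a valuation ring to a splitting field *)

Lemma adjoin_subring (E : fieldType) (A : E -> Prop) (a : E) : is_subring A ->
  is_subring (fun b => exists2 p, poly_over A p & b = p.[a]).
Proof.
move=> hA; split; first by exists 1%:P; [apply: poly_overC => //; exact: subring1 | rewrite hornerC].
split=> _ _ [p hp ->] [q hq ->].
  by exists (p - q); [exact: poly_overB | rewrite hornerD hornerN].
by exists (p * q); [exact: poly_overM | rewrite hornerM].
Qed.

Section ValuationExtension.
Variables (L E : fieldType) (iota : {rmorphism L -> E}) (V : L -> Prop).
Hypothesis hV : is_valuation_ring_of (fun _ => True) V.
Let hR : is_subring V. Proof. by case: hV. Qed.

(** Only a subring is asked for, so that Zorn's lemma applies; the maximal ones turn out to be
    valuation rings. *)
Definition lies_over (A : E -> Prop) := is_subring A /\ forall a, A (iota a) <-> V a.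

(** The maximal ideal of [V] generates the unit ideal of [A[a]], witnessed in degree at most [n]. A
    single [t] is enough, because among finitely many elements of the maximal ideal one divides all
    the others. *)
Definition unit_relation (A : E -> Prop) (n : nat) (a : E) :=
  exists t p, [/\ maxid V t, poly_over A p, (size p <= n.+1)%N & 1 = iota t * p.[a]].

Lemma lies_over_proper A t c : lies_over A -> maxid V t -> A c -> 1 = iota t * c -> False.
Proof.
move=> [hA hAV] /(maxidE hV) ht hc e.
have nt : t != 0 by apply/eqP => t0; move/eqP: e; rewrite t0 rmorph0 mul0r oner_eq0.
apply: ht; apply/(vleE hV _ nt); rewrite div1r; apply/hAV; rewrite fmorphV.
suff -> : (iota t)^-1 = c by [].
by rewrite -[LHS]mulr1 e mulKf // fmorph_eq0.
Qed.

(* With [u = 1 - t' q_0], multiplying the first relation by [u] and using the second one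
   to rewrite [u a^m] lowers the degree of the first. *)
Lemma unit_relations_absurd A N : lies_over A -> forall n m a, (n + m <= N)%N -> a != 0 ->
  unit_relation A n a -> unit_relation A m a^-1 -> False.
Proof.
move=> hAV; have [hA hAE] := hAV.
elim: N => [|N IH] n m a.
  rewrite leqn0 addn_eq0 => /andP[/eqP -> _] _ [t [p [ht hp sp e]]] _.
  by apply: (lies_over_proper hAV ht (hp 0%N)); rewrite e (size1_polyC sp) hornerC coefC.
(* The two relations are exchanged by replacing [a] with its inverse. *)
wlog le_mn : n m a / (m <= n)%N => [hw|].
  move=> hN na hn hm; case: (leqP m n) => h; first exact: (hw n m a).
  apply: (hw m n a^-1); rewrite ?invrK ?invr_eq0 //; first exact: ltnW.
  by rewrite addnC.
move=> hN na [t [p [ht hp sp e]]] [t' [q [ht' hq sq e']]].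
case: m => [|m] in le_mn hN sq.
  apply: (lies_over_proper hAV ht' (hq 0%N)).
  by rewrite e' (size1_polyC sq) hornerC coefC.
case: n => [//|n] in le_mn hN sp.
pose u := 1 - iota t' * q`_0.
(* [q1] reverses [q] without its constant term, so [q1[a] = (q[a^-1] - q_0) a^(m+1)]. *)
pose q1 := \poly_(k < m.+1) q`_(m.+1 - k).
have hu : u * a ^+ m.+1 = iota t' * q1.[a].
  have -> : u * a ^+ m.+1 = iota t' * (q.[a^-1] * a ^+ m.+1 - q`_0 * a ^+ m.+1).
    by rewrite mulrBr mulrA -e' mul1r /u mulrBl mul1r mulrA.
  congr (_ * _); rewrite (horner_coef_wide _ sq) big_ord_recl expr0 mulr1 mulrDl addrAC subrr add0r.
  rewrite horner_poly mulr_suml (reindex_inj rev_ord_inj) /=; apply: eq_bigr => i _.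
  rewrite /bump /= add1n subSS.
  have hi : (m - i < m.+1)%N by rewrite ltnS leq_subr.
  rewrite -mulrA; congr (q`_ _ * _); first by rewrite subSn // -ltnS.
  rewrite exprVn; apply: (mulfI (expf_neq0 (m - i).+1 na)).
  rewrite mulVKf ?expf_neq0 // -exprD; congr (_ ^+ _).
  by rewrite addSn subnK // -ltnS.
pose p1 := \poly_(i < n.+1) p`_i.
have hp1 : p.[a] = p1.[a] + p`_n.+1 * a ^+ (n.+1 - m.+1) * a ^+ m.+1.
  rewrite (horner_coef_wide _ sp) big_ord_recr /= horner_poly; congr (_ + _).
  by rewrite -mulrA -exprD subnK.
pose r := u *: p1 + (p`_n.+1 * iota t') *: ('X^(n.+1 - m.+1) * q1).
have hur : u = iota t * r.[a].
  rewrite !(hornerD, hornerZ, hornerM, hornerXn).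
  rewrite -[LHS]mulr1 e mulrCA hp1; congr (_ * _).
  rewrite mulrDr; congr (_ + _).
  by rewrite mulrCA hu; rewrite -!mulrA; congr (_ * _); rewrite mulrCA.
have At' : A (iota t') by apply/hAE; case: ht'.
have At : A (iota t) by apply/hAE; case: ht.
have Au : A u by apply: subringB => //; [exact: subring1 | exact: subringM].
have hr : poly_over A r.
  apply: poly_overD => //; apply: poly_overZ => //.
  - by move=> i; rewrite coef_poly; case: ifP => // _; exact: subring0.
  - exact: subringM.
  - apply: poly_overM => //; first by apply: poly_over_exp => //; exact: poly_overX.
    by move=> i; rewrite coef_poly; case: ifP => // _; exact: subring0.
have sr : (size r <= n.+1)%N.
  rewrite (leq_trans (size_polyD _ _)) // geq_max; apply/andP; split.
    by rewrite (leq_trans (size_scale_leq _ _)) // size_poly.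
  rewrite (leq_trans (size_scale_leq _ _)) // (leq_trans (size_polyMleq _ _)) //.
  rewrite size_polyXn /=.
  have := size_poly m.+1 (fun k => q`_(m.+1 - k)); rewrite -/q1 => h.
  by rewrite (leq_trans (leq_add (leqnn _) h)) // subnK.
have e1 : 1 = iota t * r.[a] + iota t' * q`_0 by rewrite -hur /u subrK.
have sC c (g : {poly E}) : (size g <= n.+1)%N -> (size (g + c%:P)%R <= n.+1)%N.
  move=> hg; rewrite (leq_trans (size_polyD _ _)) // geq_max hg.
  by rewrite (leq_trans (size_polyC_leq1 _)).
apply: (IH n m.+1 a) => //; last by exists t', q.
(* The relation [1 = t r[a] + t' q_0] involves two elements of the maximal ideal. The one of smaller
   value divides the other and can be factored out, which leaves a unit relation of degree [n]. *)
have mul_of (s s' : L) : maxid V s -> vle V s s' -> exists2 w, A (iota w) & s' = s * w.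
  move=> hs [->|[ns hw]]; first by exists 0; rewrite ?mulr0 // rmorph0; exact: subring0.
  by exists (s' / s); [apply/hAE | rewrite mulrC mulfVK].
case: (vle_total hV t t') => [/(mul_of _ _ ht)|/(mul_of _ _ ht')] [w hw ew].
  exists t, (r + (iota w * q`_0)%:P); split=> //; last 1 first.
  - by rewrite hornerD hornerC mulrDr mulrA -rmorphM -ew -e1.
  - by apply: poly_overD => //; apply: poly_overC => //; exact: subringM.
  - exact: sC.
exists t', (iota w *: r + (q`_0)%:P); split=> //; last 1 first.
- by rewrite hornerD hornerC hornerZ mulrDr mulrA -rmorphM -ew -e1.
- by apply: poly_overD => //; [exact: poly_overZ | exact: poly_overC].
- by apply: sC; rewrite (leq_trans (size_scale_leq _ _)).
Qed.

(* Maximality forces [A[a]] to contract to more than [V], hence to contain the inverse of an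
   element of the maximal ideal. *)
Lemma unit_relation_of_adjoin A a : lies_over A ->
  (forall B, lies_over B -> (forall b, A b -> B b) -> forall b, B b -> A b) ->
  ~ A a -> exists n, unit_relation A n a.
Proof.
move=> [hA hAE] hmax hna.
pose B := fun b => exists2 p, poly_over A p & b = p.[a].
have hAB b : A b -> B b by move=> hb; exists b%:P; [exact: poly_overC | rewrite hornerC].
have hB : is_subring B by exact: adjoin_subring.
have : ~ lies_over B.
  move=> h; apply: hna; apply: (hmax B) => //.
  by exists 'X; [exact: poly_overX | rewrite hornerX].
apply: contra_notP => hno; split=> // b; split; last by move=> /hAE /hAB.
move=> [p hp e]; apply: contrapT => hb; apply: hno.
have nb : b != 0 by apply/eqP => b0; apply: hb; rewrite b0; exact: subring0.
exists (size p), b^-1, p; split=> //.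
  apply/(maxidE hV) => h; apply: hb; move: h; rewrite -(vle_pmul2r hV _ _ nb) mulVf // mul1r.
  by move/(vring_ge1 hV).
by rewrite -e -rmorphM mulVf // rmorph1.
Qed.

(** Zorn's lemma gives a maximal subring lying over [V]. If it contained neither [a] nor [a^-1],
    adjoining each of them would give two unit relations, which are incompatible. *)
Lemma valuation_extension : exists W : E -> Prop,
  is_valuation_ring_of (fun _ => True) W /\ forall a, W (iota a) <-> V a.
Proof.
have h0 : lies_over (fun b => exists2 a, V a & b = iota a).
  split; first split.
  - by exists 1; [exact: subring1 | rewrite rmorph1].
  - split=> _ _ [a ha ->] [b hb ->].
      by exists (a - b); [exact: subringB | rewrite rmorphB].
    by exists (a * b); [exact: subringM | rewrite rmorphM].
  by move=> a; split=> [[b hb /fmorph_inj ->]|h] //; exists a.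
pose T := {A : E -> Prop | lies_over A}.
pose R := (fun A B : T => `[< forall b, sval A b -> sval B b >]).
have [] := @classical_sets.ZL_preorder T (exist _ _ h0) R.
- by move=> A; apply/asboolP.
- by move=> A B C /asboolP h1 /asboolP h2; apply/asboolP => b /h1 /h2.
- move=> C htot; case: (pselect (exists A, C A)) => [[A0 hA0]|hno]; last first.
    (* An empty chain is bounded by the image of [V]. *)
    by exists (exist _ _ h0) => s hs; case: hno; exists s.
  pose U := fun b => exists2 A : T, C A & sval A b.
  have hU : lies_over U.
    have two a b : U a -> U b -> exists2 A : T, C A & sval A a /\ sval A b.
      move=> [A hA ha] [B hB hb]; case: (htot A B hA hB) => /asboolP h.
        by exists B => //; split=> //; exact: h.
      by exists A => //; split=> //; exact: h.
    split; first split.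
    - by exists A0 => //; case: (svalP A0) => h _; exact: subring1.
    - split=> a b ha hb; have [A hA [h1 h2]] := two a b ha hb; exists A => //;
        case: (svalP A) => h _; [exact: subringB | exact: subringM].
    move=> a; split=> [[A _]|ha]; first by case: (svalP A) => _ ->.
    by exists A0 => //; case: (svalP A0) => _ ->.
  by exists (exist _ _ hU) => A hA; apply/asboolP => b hb; exists A.
move=> [A hA] hprem; exists A; split; last by have [] := hA.
have hmax B : lies_over B -> (forall b, A b -> B b) -> forall b, B b -> A b.
  move=> hB hAB; have /asboolP := hprem (exist _ _ hB) (asboolT hAB); exact.
split; first by have [] := hA.
split=> // a _ na; apply: contrapT => /not_orP [h1 h2].
have [n hn] := unit_relation_of_adjoin hA hmax h1.
have [m hm] := unit_relation_of_adjoin hA hmax h2.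
exact: (unit_relations_absurd hA (leqnn (n + m)) na hn hm).
Qed.
End ValuationExtension.

Section RestrictedValuation.
Variables (L E : fieldType) (iota : {rmorphism L -> E}) (V : L -> Prop) (W : E -> Prop).
Hypothesis hWV : forall a, W (iota a) <-> V a.

Lemma vle_map a b : vle W (iota a) (iota b) <-> vle V a b.
Proof.
by rewrite /vle -fmorph_div hWV fmorph_eq0; split=> -[h|h]; try (by right); left;
  apply/eqP; move/eqP: h; rewrite fmorph_eq0.
Qed.
Lemma veq_map a b : veq W (iota a) (iota b) <-> veq V a b.
Proof. by rewrite /veq !vle_map. Qed.
End RestrictedValuation.

(** * Values of algebraic elements are torsion modulo the values of the base field *)

Section Torsion.
Variables (L E : fieldType) (iota : {rmorphism L -> E}) (W : E -> Prop).
Hypothesis hW : is_valuation_ring_of (fun _ => True) W.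

(** The term of smallest value dominates the sum. *)
Lemma sum_distinct_values (F : nat -> E) (s : seq nat) : s != [::] -> uniq s ->
  (forall i, i \in s -> F i != 0) ->
  (forall i j, i \in s -> j \in s -> i != j -> ~ veq W (F i) (F j)) ->
  exists2 i, i \in s & veq W (\sum_(i <- s) F i) (F i).
Proof.
elim: s => // i s IH _ /= /andP[his us] hF hd.
have [->|ns] := eqVneq s [::].
  by exists i; [rewrite inE | rewrite big_seq1; exact: veq_refl].
have [||j hj hsj] := IH ns us.
- by move=> k hk; apply: hF; rewrite inE hk orbT.
- by move=> k l hk hl; apply: hd; rewrite inE ?hk ?hl orbT.
have hij : i != j by apply: contraNneq his => ->.
have hji : j \in i :: s by rewrite inE hj orbT.
have hii : i \in i :: s by rewrite inE eqxx.
rewrite big_cons; case: (vle_total hW (F i) (F j)) => h.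
  exists i => //; apply: (veq_sym (veq_addr hW _)) => h2.
  apply: (hd i j) => //; split=> //; apply: (vle_trans hW) h2; exact: hsj.2.
exists j => //; rewrite addrC; apply: (veq_trans hW _ hsj).
apply: (veq_sym (veq_addr hW _)) => h2.
apply: (hd i j) => //; split=> //; apply: (vle_trans hW h2); exact: hsj.1.
Qed.

(** The nonzero terms of the vanishing sum [p(a)] cannot all have distinct values. If [p_i a^i] and
    [p_j a^j] with [i < j] share one, then [a^(j-i)] has the value of [p_i / p_j]. *)
Lemma algebraic_torsion (p : {poly L}) (a : E) : p != 0 -> a != 0 ->
  root (map_poly iota p) a ->
  exists k c, [/\ (0 < k)%N, c != 0 & veq W (a ^+ k) (iota c)].
Proof.
move=> np na /eqP ra.
pose s := [seq i <- index_iota 0 (size p) | p`_i != 0].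
pose F i := iota p`_i * a ^+ i.
have hF i : i \in s -> F i != 0.
  by rewrite mem_filter => /andP[h _]; rewrite mulf_neq0 ?expf_neq0 // fmorph_eq0.
have hsum : \sum_(i <- s) F i = 0.
  rewrite -[RHS]ra (horner_coef_wide _ (size_poly _ _)) -(big_mkord xpredT (fun i => (map_poly iota p)`_i * a ^+ i)) /=.
  rewrite big_filter big_mkcond /=; apply: eq_bigr => i _; rewrite coef_map /F.
  by case: eqP => //= ->; rewrite rmorph0 mul0r.
have ns : s != [::].
  rewrite -has_filter; apply/hasP; exists (size p).-1; last by rewrite -lead_coefE lead_coef_eq0.
  by rewrite mem_index_iota /= ltn_predL size_poly_gt0.
have [i [j [hi hj hij hv]]] : exists i j, [/\ i \in s, j \in s, (i < j)%N & veq W (F i) (F j)].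
  apply: contrapT => hno.
  have [|i hi] := sum_distinct_values ns (filter_uniq _ (iota_uniq _ _)) hF.
    move=> i j hi hj hij hv; apply: hno; case: (ltngtP i j) => h.
    - by exists i, j.
    - by exists j, i; split=> //; exact: veq_sym.
    - by rewrite h eqxx in hij.
  by rewrite hsum => -[/vle_0x h _]; have := hF i hi; rewrite h eqxx.
exists (j - i)%N, (p`_i / p`_j).
move: hi hj; rewrite !mem_filter => /andP[hi _] /andP[hj _].
split; first by rewrite subn_gt0.
  by rewrite mulf_neq0 ?invr_eq0.
rewrite rmorphM /= fmorphV; move: hv.
have -> : F j = a ^+ (j - i) * (iota p`_j * a ^+ i).
  by rewrite mulrCA -exprD subnK // ltnW.
have nj : iota p`_j != 0 by rewrite fmorph_eq0.
have ni : a ^+ i != 0 by rewrite expf_neq0.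
have -> : F i = iota p`_i / iota p`_j * (iota p`_j * a ^+ i).
  by rewrite /F mulrA mulfVK.
by move=> [/(vle_pmul2r hW _ _ (mulf_neq0 nj ni)) h1 /(vle_pmul2r hW _ _ (mulf_neq0 nj ni)) h2].
Qed.
End Torsion.

Lemma exists_irreducible_factor (F : fieldType) (p : {poly F}) : (1 < size p)%N ->
  exists2 g, irreducible_poly g & g %| p.
Proof.
move=> sp.
pose P n := `[< exists g : {poly F}, [/\ size g = n, (1 < n)%N & g %| p] >].
have exP : exists n, P n by exists (size p); apply/asboolP; exists p.
case: (ex_minnP exP) => n /asboolP [g [<- sg gp]] hmin.
exists g => //; split=> // q sq qg.
have nq : q != 0.
  by apply: contraTneq sg => q0; rewrite q0 dvd0p in qg; rewrite (eqP qg) size_poly0.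
have sq1 : (1 < size q)%N by rewrite ltn_neqAle eq_sym sq size_poly_gt0.
rewrite -(dvdp_size_eqp qg) eqn_leq dvdp_leq //=; last first.
  by apply: contraTneq sg => ->; rewrite size_poly0.
by apply: hmin; apply/asboolP; exists q; split=> //; exact: dvdp_trans gp.
Qed.

Definition torsion_over (L E : fieldType) (iota : L -> E) (W : E -> Prop) :=
  forall a : E, a != 0 -> exists k (c : L), [/\ (0 < k)%N, c != 0 & veq W (a ^+ k) (iota c)].

(** Roots are adjoined one at a time, by induction on a bound for the degree: each step is a finite
    extension by a root of an irreducible factor, to which the valuation extends. Torsion passes
    through the tower, with exponents multiplied. *)
Lemma splitting_valuation_extension n : forall (L : fieldType) (V : L -> Prop) (p : {poly L}),
  is_valuation_ring_of (fun _ => True) V -> p != 0 -> (size p <= n)%N ->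
  exists (E : fieldType) (iota : {rmorphism L -> E}) (W : E -> Prop) (s : seq E),
    [/\ is_valuation_ring_of (fun _ => True) W, forall a, W (iota a) <-> V a,
        torsion_over iota W
      & map_poly iota p = iota (lead_coef p) *: \prod_(a <- s) ('X - a%:P)].
Proof.
elim: n => [|n IH] L V p hV np sp.
  by move: sp; rewrite leqn0 size_poly_eq0 (negbTE np).
have [sp1|sp1] := leqP (size p) 1.
  exists L, idfun, V, [::]; split=> //.
    by move=> a na; exists 1%N, a; split=> //; rewrite expr1; exact: veq_refl.
  rewrite map_poly_id // big_nil (size1_polyC sp1) lead_coefC -mul_polyC mulr1.
  by [].
have [g irrg gp] := exists_irreducible_factor sp1.
have [E1 _ [z rz _]] := irredp_FAdjoin irrg.
pose iota1 : {rmorphism L -> E1} := GRing.in_alg E1.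
have [W1 [hW1 hW1V]] := valuation_extension iota1 hV.
have tors1 : torsion_over iota1 W1.
  move=> a na; have /polyOver1P [q eq] := minPolyOver 1%AS a.
  apply: (algebraic_torsion hW1 (p := q)) => //; last by rewrite -eq root_minPoly.
  by have := monic_minPoly 1%AS a; rewrite eq; apply: contraTneq => ->; rewrite rmorph0 monicE lead_coef0 eq_sym oner_eq0.
have /factor_theorem [p1 ep1] : root (map_poly iota1 p) z.
  by apply: root_dvdp rz; rewrite // dvdp_map.
have np1 : p1 != 0.
  apply: contraTneq np => p10; move/eqP: ep1; rewrite p10 mul0r map_poly_eq0.
  by move=> ->.
have sp1' : (size p1 <= n)%N.
  rewrite -ltnS; apply: leq_trans sp; rewrite -(size_map_poly iota1) ep1.
  by rewrite size_mul ?polyXsubC_eq0 // size_XsubC addn2.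
have [E [iota2 [W [s [hW hWW1 tors2 es]]]]] := IH E1 W1 p1 hW1 np1 sp1'.
pose iota : {rmorphism L -> E} := iota2 \o iota1.
exists E, iota, W, (iota2 z :: s).
split=> //.
- by move=> a; rewrite /= hWW1 hW1V.
- move=> a /tors2 [k [c [k0 nc hk]]].
  have [l [c' [l0 nc' hl]]] := tors1 c nc.
  exists (k * l)%N, c'; split=> //; first by rewrite muln_gt0 k0.
  rewrite exprM; apply: (veq_trans hW (veq_exp hW l hk)).
  by rewrite /= -rmorphXn; apply/(veq_map hWW1).
have -> : map_poly iota p = map_poly iota2 (map_poly iota1 p) by rewrite -map_poly_comp.
have lp1 : lead_coef p1 = iota1 (lead_coef p).
  by rewrite -(lead_coef_map iota1) ep1 lead_coefM lead_coefXsubC mulr1.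
rewrite ep1 rmorphM /= es lp1 rmorphB /= map_polyX map_polyC /= big_cons.
by rewrite mulrC -scalerAr.
Qed.

(** * Symmetric functions of the roots *)

Section SymmetricFunctions.
Variables (E : fieldType) (F : E -> Prop) (n : nat) (s : n.-tuple E).
Hypothesis hF : is_subring F.
Hypothesis hs : poly_over F (\prod_(a <- s) ('X - a%:P)).
Local Notation ev := (mmap (intr : int -> E) (tnth s)).

Lemma mmap_mesym k :
  ev (mesym n int k) = \sum_(h : {set 'I_n} | #|h| == k) \prod_(i in h) tnth s i.
Proof.
rewrite /mesym rmorph_sum /=; apply: eq_bigr => h _.
by rewrite rmorph_prod; apply: eq_bigr => i _; rewrite /= mmapX mmap1U.
Qed.

Lemma elementary_symmetric_in k : (k <= n)%N ->
  F (\sum_(h : {set 'I_n} | #|h| == k) \prod_(i in h) tnth s i).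
Proof.
move=> hk; have hk' : (k < n.+1)%N by [].
have := mroots_coeff s (Ordinal hk') => /=.
have -> : (mesym n E k).@[tnth s] = \sum_(h : {set 'I_n} | #|h| == k) \prod_(i in h) tnth s i.
  rewrite /mesym rmorph_sum /=; apply: eq_bigr => h _.
  by rewrite rmorph_prod; apply: eq_bigr => i _; rewrite /= mevalXU.
move=> e; rewrite -[X in F X](signrMK k) -e; apply: (subringM hF); last exact: hs.
by apply: (subringX hF); apply: (subringN hF); exact: subring1.
Qed.

(** By the fundamental theorem [p] is an integer polynomial in the elementary symmetric polynomials,
    and integers lie in every subring. *)
Lemma symmetric_in (p : {mpoly int[n]}) : p \is symmetric -> F (ev p).
Proof.
move=> /sym_fundamental [t [<- _]].
rewrite comp_mpolyEX rmorph_sum /=; apply: (subring_sum hF) => m _.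
rewrite mmapZ; apply: (subringM hF); first exact: subring_int.
rewrite comp_mpolyX rmorph_prod; apply: (subring_prod hF) => i _.
rewrite rmorphXn; apply: (subringX hF).
rewrite tnth_mktuple /= mmap_mesym; apply: elementary_symmetric_in.
exact: ltn_ord.
Qed.

Lemma power_sum_in k : F (\sum_(a <- s) a ^+ k).
Proof.
have -> : \sum_(a <- s) a ^+ k = ev (\sum_(i < n) 'X_i ^+ k).
  rewrite rmorph_sum big_tuple /=; apply: eq_bigr => i _.
  by rewrite rmorphXn /= mmapX mmap1U.
apply: symmetric_in; apply/issymP => g; rewrite rmorph_sum /=.
rewrite [RHS](reindex_inj (@perm_inj _ g)); apply: eq_bigr => i _.
by rewrite rmorphXn /= /msym mmapX mmap1U.
Qed.

(** A permutation of the variables permutes the subsets of size [m], so the coefficients of the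
    generic resolvent are symmetric polynomials. *)
Lemma subset_resolvent_in m :
  poly_over F (\prod_(h : {set 'I_n} | #|h| == m) ('X - (\prod_(i in h) tnth s i)%:P)).
Proof.
pose B : {poly {mpoly int[n]}} :=
  \prod_(h : {set 'I_n} | #|h| == m) ('X - (\prod_(i in h) 'X_i)%:P).
have -> : \prod_(h : {set 'I_n} | #|h| == m) ('X - (\prod_(i in h) tnth s i)%:P)
    = map_poly ev B.
  rewrite rmorph_prod; apply: eq_bigr => h _.
  rewrite rmorphB /= map_polyX map_polyC /=; congr (_ - _%:P).
  by rewrite rmorph_prod; apply: eq_bigr => i _; rewrite /= mmapX mmap1U.
move=> k; rewrite coef_map; apply: symmetric_in; apply/issymP => g.
rewrite -(coef_map (msym g)); suff -> : map_poly (msym g) B = B by [].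
rewrite rmorph_prod [RHS](reindex_inj (imset_inj (@perm_inj _ g))) /=.
apply: eq_big => h; first by rewrite card_imset //; exact: perm_inj.
move=> _; rewrite rmorphB /= map_polyX map_polyC /=; congr (_ - _%:P).
rewrite rmorph_prod big_imset /=; last by move=> i j _ _; exact: perm_inj.
by apply: eq_bigr => i _; rewrite /= /msym mmapX mmap1U.
Qed.
End SymmetricFunctions.

(** * Pseudo limits and polynomials of minimal degree *)

Lemma horner_prodXsub (E : fieldType) (s : seq E) y :
  (\prod_(a <- s) ('X - a%:P)).[y] = \prod_(a <- s) (y - a).
Proof. by rewrite horner_prod; apply: eq_bigr => a _; rewrite hornerXsubC. Qed.

(** Induction on the size: the divided difference [(Q - Q(u0)) / (X - u0)] is smaller and takes
    values in [F] on the rest of [U], which is still infinite. *)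
Lemma poly_over_interpolation (E : fieldType) (F : E -> Prop) (hF : is_subfield F) n :
  forall (Q : {poly E}) (U : E -> Prop), (size Q <= n)%N ->
  (forall u, U u -> F u /\ F Q.[u]) -> (forall l : seq E, exists2 u, U u & u \notin l) ->
  poly_over F Q.
Proof.
have [hFr hFV] := hF.
elim: n => [|n IH] Q U sQ hU hinf.
  by move: sQ; rewrite leqn0 size_poly_eq0 => /eqP ->; exact: poly_over0.
have [u0 hu0 _] := hinf [::]; have [Fu0 FQu0] := hU u0 hu0.
have /factor_theorem [Q1 eQ] : root (Q - Q.[u0]%:P) u0.
  by rewrite rootE hornerD hornerN hornerC subrr.
have eQ' : Q = Q1 * ('X - u0%:P) + Q.[u0]%:P by rewrite -eQ subrK.
rewrite eQ'; apply: poly_overD => //; last exact: poly_overC.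
apply: poly_overM => //; last by apply: poly_overB => //; [exact: poly_overX | exact: poly_overC].
apply: (IH Q1 (fun u => U u /\ u != u0)).
- have [->|nQ1] := eqVneq Q1 0; first by rewrite size_poly0.
  have : (size (Q - Q.[u0]%:P)%R <= n.+1)%N.
    rewrite (leq_trans (size_polyD _ _)) // geq_max sQ size_polyN.
    by rewrite (leq_trans (size_polyC_leq1 _)).
  by rewrite eQ size_mul ?polyXsubC_eq0 // size_XsubC addn2.
- move=> u [hu nu]; have [Fu FQu] := hU u hu; split=> //.
  have nz : u - u0 != 0 by rewrite subr_eq0.
  have -> : Q1.[u] = (Q.[u] - Q.[u0]) / (u - u0).
    by rewrite {1}eQ' hornerD hornerC addrK hornerM hornerXsubC mulfK.
  by apply: (subringM hFr); [exact: subringB | apply: hFV; exact: subringB].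
move=> l; have [u hu] := hinf (u0 :: l); rewrite inE negb_or => /andP[h1 h2].
by exists u.
Qed.

Section Eventually.
Variables (d : Order.disp_t) (I : orderType d).

Definition eventually (P : I -> Prop) := exists i0, forall i, (i0 <= i)%O -> P i.

Lemma eventually_and P Q : eventually P -> eventually Q -> eventually (fun i => P i /\ Q i).
Proof.
move=> [i hi] [j hj]; exists (Order.max i j) => k; rewrite ge_max => /andP[h1 h2].
by split; [exact: hi | exact: hj].
Qed.
Lemma eventually_mono (P Q : I -> Prop) : (forall i, P i -> Q i) -> eventually P -> eventually Q.
Proof. by move=> h [i hi]; exists i => j /hi /h. Qed.
Lemma eventually_all (T : eqType) (s : seq T) (P : T -> I -> Prop) (i0 : I) :
  (forall a, a \in s -> eventually (P a)) -> eventually (fun i => forall a, a \in s -> P a i).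
Proof.
elim: s => [|a s IH] h; first by exists i0.
have h1 : eventually (P a) by apply: h; rewrite inE eqxx.
have h2 : eventually (fun i => forall b, b \in s -> P b i).
  by apply: IH => b hb; apply: h; rewrite inE hb orbT.
apply: eventually_mono (eventually_and h1 h2) => i [hi1 hi2] b.
by rewrite inE => /orP[/eqP ->|/hi2].
Qed.
End Eventually.

Section PseudoLimits.
Variables (E : fieldType) (W : E -> Prop) (d : Order.disp_t) (I : orderType d).
Variables (v : I -> E) (x : E) (i0 : I).
Hypothesis hW : is_valuation_ring_of (fun _ => True) W.
Hypothesis hlim : forall i : I, exists j, (i < j)%O.
Hypothesis hinc : forall i i', (i < i')%O -> ~ vle W (x - v i') (x - v i).
Local Notation "a <~ b" := (vle W a b) (at level 70).
Local Notation "a <! b" := (~ vle W b a) (at level 70).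

(* Given one pseudo limit [x] of [v], the other ones are the [a] with
   [val (x - v i) <= val (x - a)] for all [i]. *)
Definition plim a := forall i, x - v i <~ x - a.

Lemma sub_neq0 i : x - v i != 0.
Proof. by have [j /hinc h] := hlim i; exact: vlt_neq0 h. Qed.

Lemma veq_sub_nonlimit a i : x - a <! x - v i -> veq W (v i - a) (x - a).
Proof.
move=> h; have -> : v i - a = (x - a) - (x - v i) by rewrite opprB [RHS]addrC addrA subrK.
by apply: veq_sym; exact: veq_subr.
Qed.
(** A later index shows that [x - a] has strictly larger value than [x - v i], so the latter
    dominates [v i - a]. *)
Lemma veq_sub_plim a i : plim a -> veq W (v i - a) (x - v i).
Proof.
move=> h; have [j hij] := hlim i.
have hlt : x - v i <! x - a by apply: (vlt_le_trans hW (hinc hij)).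
apply: (veq_trans hW (veq_subC hW _ _)).
have -> : a - v i = (x - v i) - (x - a) by rewrite opprB [RHS]addrC addrA subrK.
by apply: veq_sym; exact: veq_subr.
Qed.
Lemma nonlimit_eventually a : ~ plim a -> eventually (fun i => x - a <! x - v i).
Proof.
move=> /existsNP [i hi]; exists i => j; rewrite le_eqVlt => /orP[/eqP <- //|hij].
exact: (vlt_le_trans hW hi (vltW hW (hinc hij))).
Qed.

(** For a root that is not a pseudo limit, the second clause says that [v i] has come closer to [x]
    than [a] is; then [v i - a] has the fixed value of [x - a]. *)
Definition root_behaviour i a :=
  (plim a -> veq W (v i - a) (x - v i)) /\ (~ plim a -> x - a <! x - v i).

Lemma root_behaviour_eventually (s : seq E) :
  eventually (fun i => forall a, a \in s -> root_behaviour i a).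
Proof.
apply: eventually_all => // a _; case: (pselect (plim a)) => ha.
  by exists i0 => i _; split=> // _; exact: veq_sub_plim.
by apply: eventually_mono (nonlimit_eventually ha) => i hi.
Qed.
Lemma root_behaviour_neq0 i a : root_behaviour i a -> v i - a != 0.
Proof.
move=> [h1 h2]; case: (pselect (plim a)) => ha.
  by rewrite (veq_eq0 (h1 ha)) sub_neq0.
by rewrite (veq_eq0 (veq_sub_nonlimit (h2 ha))); exact: vlt_neq0 (h2 ha).
Qed.
Lemma root_behaviour_le_dist i a : root_behaviour i a -> v i - a <~ x - v i.
Proof.
move=> [h1 h2]; case: (pselect (plim a)) => ha; first by case: (h1 ha).
have [h _] := veq_sub_nonlimit (h2 ha).
by apply: (vle_trans hW h); apply: vltW (h2 ha).
Qed.
Lemma root_behaviour_le i a : root_behaviour i a -> v i - a <~ x - a.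
Proof.
move=> [h1 h2]; case: (pselect (plim a)) => ha.
  by have [h _] := h1 ha; apply: (vle_trans hW h).
by have [h _] := veq_sub_nonlimit (h2 ha).
Qed.

Lemma prod_neq0_eventually (s : seq E) : eventually (fun i => \prod_(a <- s) (v i - a) != 0).
Proof.
apply: eventually_mono (root_behaviour_eventually s) => i hi.
by rewrite prodf_seq_neq0; apply/allP => a ha; apply: root_behaviour_neq0; exact: hi.
Qed.
Lemma prod_le_eventually (s : seq E) :
  eventually (fun i => \prod_(a <- s) (v i - a) <~ \prod_(a <- s) (x - a)).
Proof.
apply: eventually_mono (root_behaviour_eventually s) => i hi.
by apply: vle_prod => // a ha _; apply: root_behaviour_le; exact: hi.
Qed.
(** Factors at pseudo limits strictly increase in value, and the values of the other factors are
    eventually constant. *)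
Lemma prod_lt_eventually (s : seq E) a1 : a1 \in s -> plim a1 ->
  eventually (fun i => forall i', (i < i')%O ->
    \prod_(a <- s) (v i - a) <! \prod_(a <- s) (v i' - a)).
Proof.
move=> ha1 hp; have [j hj] := root_behaviour_eventually s.
exists j => i hji i' hii'; have hji' : (j <= i')%O by apply: le_trans hji (ltW hii').
have hlt : v i - a1 <! v i' - a1.
  have [h _] := veq_sub_plim i hp; have [_ h'] := veq_sub_plim i' hp.
  by apply: (vle_lt_trans hW h); apply: (vlt_le_trans hW) h'; exact: hinc.
apply: (vlt_prod hW (i0 := a1)) => // a ha _; split.
  by apply: root_behaviour_neq0; exact: hj.
case: (pselect (plim a)) => hpa.
  have [h _] := veq_sub_plim i hpa; have [_ h'] := veq_sub_plim i' hpa.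
  by apply: (vle_trans hW h); apply: (vle_trans hW) h'; apply: vltW => //; exact: hinc.
have [_ /(_ hpa) h1] := hj i hji a ha; have [_ /(_ hpa) h2] := hj i' hji' a ha.
have [h _] := veq_sub_nonlimit h1; have [_ h'] := veq_sub_nonlimit h2.
exact: (vle_trans hW h).
Qed.

Section Minimal.
Variable F : E -> Prop.
Hypothesis hF : is_subfield F.
(** This form of Hensel's lemma is common to both cases: it holds for the image of [K] when [V] is
    Henselian, and for the closure of that image in rank one. *)
Hypothesis hensel : forall r rs, poly_over F (\prod_(a <- r :: rs) ('X - a%:P)) ->
  1 <! r - 1 -> (forall a, a \in rs -> 1 <! a) -> F r.
Let hFr : is_subring F. Proof. by case: hF. Qed.

(* The product over [S] has strictly the smallest value among the products over sets of [#|S|]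
   roots, so its quotient by the elementary symmetric function [e] is the only root congruent
   to 1 of the resolvent whose other roots lie in the maximal ideal. *)
Lemma hensel_subset_product n (z : n.-tuple E) (S : {set 'I_n}) c :
  poly_over F (\prod_(a <- z) ('X - a%:P)) -> c != 0 ->
  (forall j, j \in S -> tnth z j <~ c) -> (forall j, j \notin S -> c <! tnth z j) ->
  F (\prod_(j in S) tnth z j).
Proof.
move=> hz nc hS hnS.
pose b (h : {set 'I_n}) := \prod_(j in h) tnth z j.
have nzS j : j \in S -> tnth z j != 0.
  by move=> /hS h; apply: contraNneq nc => z0; move: h; rewrite z0 => /vle_0x ->.
have nbS : b S != 0 by apply/prodf_neq0.
(* The factors over the intersection of [h] and [S] cancel. The two differences have equally many
   elements, with values at most that of [c] in [S :\: h] and above it in [h :\: S]. *)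
have hb (h : {set 'I_n}) : #|h| == #|S| -> h != S -> b S <! b h.
  move=> /eqP chS nhS.
  rewrite /b (big_setID (A := S) h) /= (big_setID (A := h) S) /= setIC ![_ * \prod_(_ in _ :\: _) _]mulrC.
  have hcard : #|h :\: S| = #|S :\: h|.
    by apply/eqP; rewrite -(eqn_add2l #|h :&: S|) cardsID setIC cardsID chS.
  have /set0Pn [j0 hj0] : h :\: S != set0.
    apply: contraNneq nhS => h0; rewrite eqEcard chS leqnn andbT -setD_eq0.
    by rewrite h0.
  apply: vlt_mul => //; last 2 first.
  - exact: vle_refl.
  - by apply/prodf_neq0 => j; rewrite inE => /andP[h1 h2]; exact: nzS.
  apply: (@vle_lt_trans _ _ hW (\prod_(j in S :\: h) c)).
    by apply: vle_prod => // j _; rewrite inE => /andP[_ /hS].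
  rewrite prodr_const -hcard -prodr_const.
  apply: (vlt_prod hW (i0 := j0)) => //; first by move=> j _; rewrite inE => /andP[/hnS h1 _]; split=> //; exact: vltW.
  by apply: hnS; move: hj0; rewrite inE => /andP[].
pose e := \sum_(h : {set 'I_n} | #|h| == #|S|) b h.
have Fe : F e.
  by apply: elementary_symmetric_in => //; rewrite -[X in (_ <= X)%N]card_ord; exact: max_card.
have bSe : veq W (b S) e.
  rewrite /e (bigD1 S) //=; apply: veq_addr => //.
  by apply: vlt_sum => // h /andP[h1 h2]; exact: hb.
have ne : e != 0 by rewrite -(veq_eq0 bSe).
pose r h := b h / e.
pose rs := [seq r h | h <- enum [pred h : {set 'I_n} | (#|h| == #|S|) && (h != S)]].
suff : F (r S) by move=> h; rewrite -[\prod_(_ in _) _](mulfVK ne); exact: subringM.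
apply: (hensel (rs := rs)).
- rewrite big_cons big_map big_enum /=.
  rewrite -(bigD1 (P := fun h : {set 'I_n} => #|h| == #|S|) S) //=.
  have hB := subset_resolvent_in hFr hz #|S|.
  (* Roots divided by [e]: substitute [e X] for the variable and divide each factor by [e]. *)
  have -> : \prod_(h : {set 'I_n} | #|h| == #|S|) ('X - (r h)%:P) =
    (\prod_(h : {set 'I_n} | #|h| == #|S|) e^-1) *:
    ((\prod_(h : {set 'I_n} | #|h| == #|S|) ('X - (b h)%:P)) \Po (e *: 'X)).
    rewrite rmorph_prod -scaler_prod; apply: eq_bigr => h _ /=.
    rewrite comp_polyB comp_polyX comp_polyC scalerBr scalerA mulVf // scale1r.
    by rewrite -mul_polyC -polyCM mulrC.
  apply: poly_overZ => //; first by apply: subring_prod => // _ _; exact: hF.2.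
  by apply: poly_over_comp => //; apply: poly_overZ => //; exact: poly_overX.
- rewrite -[1 in X in _ <! X](divff ne) -mulrBl => /(vle_divl hW _ _ ne); rewrite mul1r => h.
  have : e <! b S - e.
    rewrite -opprB; apply: vlt_oppr => //.
    have -> : e - b S = \sum_(h : {set 'I_n} | (#|h| == #|S|) && (h != S)) b h.
      by rewrite /e (bigD1 S) //= [LHS]addrAC subrr add0r.
    apply: vlt_sum => // h' /andP[h1 h2]; apply: (vle_lt_trans hW bSe.2); exact: hb.
  by apply.
move=> a /mapP [h]; rewrite mem_enum inE => /andP[h1 h2] -> /(vle_divl hW _ _ ne).
by rewrite mul1r => h3; apply: (hb _ h1 h2); apply: (vle_trans hW h3); exact: bSe.2.
Qed.

(** Otherwise [y] does at least as well as some late [v i]. The roots no closer to [y] than [v i] is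
    then form a proper subset [S] containing [a1], and the Hensel property puts the product of
    [X - a] over [S] in [F[X]], against the minimality of [s]. *)
Lemma minimal_polynomial_bound (s : seq E) a1 :
  (forall i, F (v i)) -> (forall y, F y -> ~ plim y) ->
  poly_over F (\prod_(a <- s) ('X - a%:P)) -> a1 \in s -> plim a1 ->
  (forall s', poly_over F (\prod_(a <- s') ('X - a%:P)) -> (exists2 a, a \in s' & plim a) ->
     (size s <= size s')%N) ->
  forall y, F y -> eventually (fun i => \prod_(a <- s) (y - a) <! \prod_(a <- s) (v i - a)).
Proof.
move=> hvF hnolim hs ha1 hp1 hmin y Fy; apply: contrapT => hno.
have [j hj] := eventually_and (nonlimit_eventually (hnolim y Fy)) (root_behaviour_eventually s).
have [i hji hi] : exists2 i, (j <= i)%O & \prod_(a <- s) (v i - a) <~ \prod_(a <- s) (y - a).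
  apply: contrapT => h; apply: hno; exists j => i hji h2; apply: h; exists i => //.
have [hyi hroot] := hj i hji.
pose c := v i - y.
have hc : veq W c (x - y) by exact: veq_sub_nonlimit.
have nc : c != 0 by rewrite (veq_eq0 hc); exact: vlt_neq0 hyi.
have hya1 : veq W (y - a1) c.
  apply: (veq_trans hW _ (veq_sym hc)).
  have -> : y - a1 = - ((x - y) - (x - a1)) by rewrite opprB opprB [RHS]addrC addrA subrK.
  apply: (veq_trans hW (veq_sym (veq_opp hW _))); apply: veq_sym; apply: veq_subr => //.
  exact: (vlt_le_trans hW hyi (hp1 i)).
pose n := size s; pose a (j : 'I_n) := tnth (in_tuple s) j.
pose S := [set j | `[< y - a j <~ c >]].
have [j1 hj1] : exists j1 : 'I_n, a j1 = a1.
  by have /tnthP [j1 ->] : a1 \in in_tuple s by []; exists j1.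
have j1S : j1 \in S by rewrite inE; apply/asboolP; rewrite hj1; case: hya1.
(* If [S] contained every root, each [y - b] would have value at most that of [v i - b], strictly so
   for [b = a1], contradicting [hi]. *)
have [j2 hj2] : exists j2, j2 \notin S.
  apply: contrapT => hall; apply: (_ : ~ _) hi.
  have hle b : b \in s -> y - b <~ c.
    move=> hb; have /tnthP [k ->] : b \in in_tuple s by [].
    apply: contrapT => hk; apply: hall; exists k; rewrite inE; exact/asboolP.
  apply: (vlt_prod hW (i0 := a1)) => //.
    move=> b /hle hb _; split.
      by apply: contraNneq nc => e; move: hb; rewrite e => /vle_0x ->.
    have -> : v i - b = (y - b) + c by rewrite /c [RHS]addrC addrA subrK.
    by apply: vle_add => //; exact: vle_refl.
  apply: (vle_lt_trans hW hya1.1); apply: (vle_lt_trans hW hc.1).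
  exact: (vlt_le_trans hW hyi (veq_sub_plim i hp1).2).
have hprod t : F t -> c <! t -> F (\prod_(j in S) (y + t - a j)).
  move=> Ft hct.
  pose z := [tuple y + t - a j | j < n].
  have hz : poly_over F (\prod_(b <- z) ('X - b%:P)).
    (* The numbers [y + t - a] are the images of the roots under the reflection [X -> y + t - X];
       each factor changes sign. *)
    have -> : \prod_(b <- z) ('X - b%:P) = (\prod_(j < n) (-1)) *:
        ((\prod_(b <- s) ('X - b%:P)) \Po ((y + t)%:P - 'X)).
      have -> : \prod_(b <- s) ('X - b%:P) = \prod_(j < n) ('X - (a j)%:P).
        by rewrite -[s in LHS]/(tval (in_tuple s)) big_tuple.
      rewrite rmorph_prod -scaler_prod big_tuple; apply: eq_bigr => k _ /=.
      rewrite tnth_mktuple comp_polyB comp_polyX comp_polyC scaleN1r.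
      by rewrite [RHS]opprB polyCB !opprB addrCA.
    apply: poly_overZ => //; first by apply: subring_prod => // _ _; apply: subringN => //; exact: subring1.
    apply: poly_over_comp => //; apply: poly_overB => //; last exact: poly_overX.
    by apply: poly_overC => //; exact: subringD.
  have -> : \prod_(j in S) (y + t - a j) = \prod_(j in S) tnth z j.
    by apply: eq_bigr => k _; rewrite tnth_mktuple.
  (* Adding [t], of value above that of [c], does not move any [y - a] across the threshold [c]. *)
  apply: (hensel_subset_product hz nc) => k; rewrite inE tnth_mktuple addrAC.
    move=> /asboolP hk; apply: (vle_trans hW _ hk).
    by apply: (veq_addr hW _).2; exact: (vle_lt_trans hW hk).
  by move=> /asboolP hk; exact: vlt_add.
pose Q := \prod_(b <- [seq a j | j <- enum S]) ('X - b%:P).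
have hQ : poly_over F Q.
  (* The translations [v k - v i] with [k > i] lie in [F] and have the value of [x - v i], which
     exceeds that of [c]. They are pairwise distinct because the distances to [x] strictly increase,
     so there are infinitely many. *)
  apply: (poly_over_interpolation hF (n := size Q) (U := fun u => exists2 k, (i < k)%O & u = y + (v k - v i))) => //.
    move=> _ [k hk ->]; have Fk : F (v k - v i) by exact: subringB.
    split; first exact: subringD.
    rewrite horner_prodXsub big_map big_enum /=; apply: hprod => //.
    have -> : v k - v i = (x - v i) - (x - v k) by rewrite opprB [RHS]addrC addrA subrK.
    apply: (vlt_le_trans hW) (veq_subr hW (hinc hk)).1.
    exact: (vle_lt_trans hW hc.1).
  move=> l; have [k0 hk0] : eventually (fun k => forall b, b \in l -> y + (v k - v i) != b).
    apply: eventually_all => // b _.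
    case: (pselect (exists k, y + (v k - v i) = b)) => [[k hk]|h]; last first.
      by exists i0 => k _; apply/eqP => hk; apply: h; exists k.
    have [k' hkk'] := hlim k; exists k' => k2 hk2; rewrite -hk.
    apply/eqP => /addrI /addIr e; have := hinc (lt_le_trans hkk' hk2).
    by rewrite e; apply; exact: vle_refl.
  have [k hk] := hlim (Order.max i k0); move: hk; rewrite gt_max => /andP[hk1 hk2].
  exists (y + (v k - v i)); first by exists k.
  by apply/negP => /(hk0 k (ltW hk2)); rewrite eqxx.
have := hmin _ hQ; rewrite size_map -cardE => h.
have : (n <= #|S|)%N.
  by apply: h; exists a1 => //; apply/mapP; exists j1; rewrite ?mem_enum.
rewrite leqNgt => /negP; apply.
have : (#|S| < #|[set: 'I_n]|)%N.
  by apply: proper_card; rewrite properT; apply: contraNneq hj2 => ->; rewrite inE.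
by rewrite cardsT card_ord.
Qed.
End Minimal.
End PseudoLimits.

(** * Rank one *)

Section Archimedean.
Variables (L : fieldType) (K V V' : L -> Prop).
Hypothesis hV' : is_valuation_ring_of (fun _ => True) V'.
Hypothesis hK : is_subfield K.
Hypothesis hVK : forall a, V a -> K a.
Hypothesis hVV' : forall a, K a -> (V a <-> V' a).
Local Notation "a <~ b" := (vle V' a b) (at level 70).
Local Notation "a <! b" := (~ vle V' b a) (at level 70).

Lemma maxid_base a : maxid V a <-> K a /\ 1 <! a.
Proof.
rewrite -(maxidE hV'); split=> [[ha h]|[ha [h1 h2]]].
  have ka := hVK ha; split=> //; split; first exact/hVV'.
  by case: h => [->|h]; [left | right => h2; apply: h; apply/hVV' => //; exact: hK.2].
by split; [exact/hVV' | case: h2 => [->|h]; [left | right => h3; apply: h; apply/hVV' => //; exact: hK.2]].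
Qed.

Lemma krull_dim_one_nontrivial : krull_dim_one V -> exists t, [/\ K t, t != 0 & 1 <! t].
Proof.
move=> [[P [Q [hP [hQ [hPQ [q [hq hnq]]]]]]] _].
have Vq : V q by exact: hQ.1.
exists q; have [] := (maxid_base q).1 _; last by move=> h1 h2; split=> //; apply/eqP => q0;
  apply: hnq; rewrite q0; exact: hP.2.1.
split=> //; right => Vq1.
have [_ [_ [_ [hM [h1 _]]]]] := hQ.
have [q0|nq] := eqVneq q 0; first by apply: hnq; rewrite q0; exact: hP.2.1.
by apply: h1; rewrite -(mulVf nq); exact: hM.
Qed.

(** If [c] had larger value than every power of [t], the elements with this property would form a
    prime ideal strictly between zero, as it contains [c], and the maximal ideal, as it misses
    [t]. *)
Lemma krull_dim_one_archimedean : krull_dim_one V ->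
  forall t c, K t -> 1 <! t -> K c -> c != 0 -> exists n, c <~ t ^+ n.
Proof.
move=> [_ hno] t c Kt ht Kc nc.
have [t0|nt] := eqVneq t 0; first by exists 1%N; rewrite t0 expr1; left.
have hKr : is_subring K by exact: hK.1.
apply: contrapT => /forallNP hbig; apply: hno.
have Vc : V c.
  by apply/hVV' => //; apply/(vring_ge1 hV'); apply: (vltW hV'); exact: (hbig 0%N).
have hV0 : V 0 by apply/hVV'; [exact: subring0 | apply: subring0; exact: hV'.1].
have hVD a b : V a -> V b -> V (a + b).
  move=> ha hb; apply/hVV'; first by apply: subringD => //; exact: hVK.
  by apply: subringD; [exact: hV'.1 | apply/hVV' => //; exact: hVK..].
have hVM a b : V a -> V b -> V (a * b).
  move=> ha hb; apply/hVV'; first by apply: subringM => //; exact: hVK.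
  by apply: subringM; [exact: hV'.1 | apply/hVV' => //; exact: hVK..].
have hV1 a : V a -> 1 <~ a.
  by move=> ha; apply/(vring_ge1 hV'); apply/hVV' => //; exact: hVK.
have le_mul a b : V a -> b <~ a * b.
  by move=> /hV1 ha; rewrite -{1}[b]mul1r; apply: vle_mul => //; exact: vle_refl.
exists (fun a => a = 0), (fun a => V a /\ forall n, t ^+ n <! a), (maxid V).
split; [|split; [|split; [|split]]].
- split; first by move=> _ ->.
  split=> //; split; first by move=> _ _ -> ->; rewrite addr0.
  split; first by move=> a _ _ ->; rewrite mulr0.
  split; first by move/eqP; rewrite oner_eq0.
  by move=> a b _ _ /eqP; rewrite mulf_eq0 => /orP[/eqP|/eqP]; [left | right].
- split; first by move=> a [].
  split; first by split=> // n /vle_0x /eqP; rewrite expf_eq0 (negbTE nt) andbF.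
  split; first by move=> a b [Va ha] [Vb hb]; split=> [|n]; [exact: hVD | exact: vlt_add].
  split; first by move=> a b Va [Vb hb]; split=> [|n]; [exact: hVM
     | apply: (vlt_le_trans hV' (hb n)); exact: le_mul].
  split; first by move=> [_ /(_ 0%N)]; rewrite expr0; apply; exact: vle_refl.
  move=> a b Va Vb [_ hab]; apply: contrapT => /not_orP [na nb].
  have [n hn] : exists n, a <~ t ^+ n.
    by apply: contrapT => /forallNP h; apply: na.
  have [m hm] : exists m, b <~ t ^+ m.
    by apply: contrapT => /forallNP h; apply: nb.
  by apply: (hab (n + m)%N); rewrite exprD; exact: vle_mul.
- split; first by move=> a [].
  split; first by split; [|left].
  split; first by move=> a b /maxid_base [Ka ha] /maxid_base [Kb hb]; apply/maxid_base;
    split; [exact: subringD | exact: vlt_add].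
  split; first by move=> a b Va /maxid_base [Kb hb]; apply/maxid_base; split;
    [apply: subringM => //; exact: hVK | apply: (vlt_le_trans hV' hb); exact: le_mul].
  split; first by move=> /maxid_base [_]; apply; exact: vle_refl.
  move=> a b Va Vb /maxid_base [_ hab]; apply: contrapT => /not_orP [na nb].
  have ha : a <~ 1 by apply: contrapT => h; apply: na; apply/maxid_base; split=> //; exact: hVK.
  have hb : b <~ 1 by apply: contrapT => h; apply: nb; apply/maxid_base; split=> //; exact: hVK.
  by apply: hab; rewrite -[X in _ <~ X]mulr1; exact: vle_mul.
- split; first by move=> a ->; split=> // n /vle_0x /eqP; rewrite expf_eq0 (negbTE nt) andbF.
  by exists c; split; [split | exact/eqP].
- split; first by move=> a [Va ha]; apply/maxid_base; split; [exact: hVK | exact: (ha 0%N)].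
  exists t; split; first exact/maxid_base.
  by move=> [_ /(_ 1%N)]; rewrite expr1; apply; exact: vle_refl.
Qed.
End Archimedean.

(** * The closure of a subfield under an archimedean valuation *)

Section Closure.
Variables (E : fieldType) (W G : E -> Prop) (t0 : E).
Hypothesis hW : is_valuation_ring_of (fun _ => True) W.
Hypothesis hG : is_subfield G.
Local Notation "a <~ b" := (vle W a b) (at level 70).
Local Notation "a <! b" := (~ vle W b a) (at level 70).
Hypothesis tors : forall a, a != 0 -> exists k c, [/\ (0 < k)%N, G c, c != 0 & veq W (a ^+ k) c].
Hypothesis arch : forall t c, G t -> 1 <! t -> G c -> c != 0 -> exists n, c <~ t ^+ n.
Hypothesis Gt0 : G t0.
Hypothesis nt0 : t0 != 0.
Hypothesis ht0 : 1 <! t0.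
Let hGr : is_subring G. Proof. by case: hG. Qed.
Let GV a : G a -> G a^-1. Proof. by case: hG => _; exact. Qed.

(** Precision is measured by nonzero elements of [G] only. Their values are cofinal in those of [E],
    so this is the topological closure of [G] in [E]. *)
Definition vclosure a := forall c, G c -> c != 0 -> exists2 b, G b & c <~ a - b.

Lemma sub_vclosure a : G a -> vclosure a.
Proof. by move=> ha c _ _; exists a => //; rewrite subrr; left. Qed.

(** A positive value is at most each of its positive multiples, one of which is, by torsion, the
    value of an element of [G]. *)
Lemma base_cofinal a : a != 0 -> exists c, [/\ G c, c != 0 & a <~ c].
Proof.
move=> na; case: (vle_total hW a 1) => h.
  by exists 1; split=> //; [exact: subring1 | exact: oner_neq0].
have [[//|k] [c [k0 Gc nc [h1 _]]]] := tors na; exists c; split=> //.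
apply: (vle_trans hW) h1; rewrite exprS -{1}[a]mulr1; apply: vle_mul => //; first exact: vle_refl.
by rewrite -(expr1n _ k); exact: vle_exp.
Qed.

Lemma base_coinitial a : exists c, [/\ G c, c != 0 & c <~ a].
Proof.
have [->|na] := eqVneq a 0; first by exists 1; split; [exact: subring1 | exact: oner_neq0 | left].
have [|c [Gc nc hc]] := @base_cofinal a^-1; first by rewrite invr_eq0.
exists c^-1; split; [exact: GV | by rewrite invr_eq0 |].
rewrite -[c^-1]mul1r; apply/(vle_divl hW) => //.
by rewrite -(mulfV na); apply: vle_mul => //; exact: vle_refl.
Qed.

Lemma vclosure_approx a c1 c2 : vclosure a -> G c1 -> c1 != 0 -> G c2 -> c2 != 0 ->
  exists b, [/\ G b, c1 <~ a - b & c2 <~ a - b].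
Proof.
move=> ha G1 n1 G2 n2; case: (vle_total hW c1 c2) => h.
  by have [b Gb hb] := ha c2 G2 n2; exists b; split=> //; exact: vle_trans hb.
by have [b Gb hb] := ha c1 G1 n1; exists b; split=> //; exact: vle_trans hb.
Qed.

Lemma vclosure_subfield : is_subfield vclosure.
Proof.
split; first split; first by apply: sub_vclosure; exact: subring1.
  split=> a a' ha ha' c Gc nc.
    have [b Gb hb] := ha c Gc nc; have [b' Gb' hb'] := ha' c Gc nc.
    exists (b - b'); first exact: subringB.
    have -> : a - a' - (b - b') = (a - b) - (a' - b').
      by rewrite !opprB addrACA [RHS]addrACA [- a' - b]addrC.
    exact: vle_sub.
  (* The approximation [b'] is chosen before [b], because the precision required of [b] depends on
     the value of [b']. *)
  have [c1 [G1 n1 h1]] := base_coinitial a.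
  have [|b' Gb' hb'] := ha' (c / c1) (subringM hGr Gc (GV G1)).
    by rewrite mulf_neq0 ?invr_eq0.
  have [c2 [G2 n2 h2]] := base_coinitial b'.
  have [|b Gb hb] := ha (c / c2) (subringM hGr Gc (GV G2)).
    by rewrite mulf_neq0 ?invr_eq0.
  exists (b * b'); first exact: subringM.
  have -> : a * a' - b * b' = (a' - b') * a + (a - b) * b'.
    by rewrite !mulrBl addrA [b' * a]mulrC subrK mulrC.
  apply: vle_add => //.
    by rewrite -[c](mulfVK n1); exact: vle_mul.
  by rewrite -[c](mulfVK n2); exact: vle_mul.
move=> a ha c Gc nc.
have [a0|na] := eqVneq a 0; first by exists 0; [exact: subring0 | rewrite a0 invr0 subr0; left].
have [c0 [G0 n0 h0]] := base_cofinal na.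
(* Precision [c0 * t0], beyond the value of [a], gives [b] the value of [a]. Precision
   [c * (c0 * c0)] compensates the denominator of [a^-1 - b^-1 = (b - a) / (a b)]. *)
have [||||b [Gb hb1 hb2]] := @vclosure_approx a (c * (c0 * c0)) (c0 * t0) ha;
  rewrite ?mulf_neq0 //; try by do !apply: subringM.
have hlt : a <! a - b.
  apply: (vle_lt_trans hW h0); apply: (vlt_le_trans hW) hb2.
  by rewrite mulrC -{2}[c0]mul1r (vle_pmul2r hW).
have hba : veq W a b by rewrite -[X in veq W _ X](subKr a); exact: veq_subr.
have nb : b != 0 by rewrite -(veq_eq0 hba).
exists b^-1; first exact: GV.
have -> : a^-1 - b^-1 = (b - a) / (a * b).
  by rewrite mulrBl invfM mulrCA divff // mulr1 mulrA divff // mul1r.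
apply/(vle_div hW); first by rewrite mulf_neq0.
apply: vle_subC => //; apply: (vle_trans hW) hb1; apply: vle_mul => //; first exact: vle_refl.
by apply: vle_mul => //; apply: (vle_trans hW hba.2).
Qed.

Lemma vclosure_closed a :
  (forall c, G c -> c != 0 -> exists2 b, vclosure b & c <~ a - b) -> vclosure a.
Proof.
move=> h c Gc nc; have [b hb hab] := h c Gc nc; have [b' Gb' hb'] := hb c Gc nc.
exists b' => //; rewrite -[a](subrK b) -addrA; exact: vle_add.
Qed.

(* Power iteration: the ratios of consecutive power sums of the roots converge to [r]. *)
Lemma vclosure_hensel r rs : poly_over vclosure (\prod_(a <- r :: rs) ('X - a%:P)) ->
  1 <! r - 1 -> (forall a, a \in rs -> 1 <! a) -> vclosure r.
Proof.
move=> hp hr hrs; have [hcr hcV] := vclosure_subfield.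
pose p k := r ^+ k + \sum_(a <- rs) a ^+ k.
have Cp k : vclosure (p k).
  have := @power_sum_in E vclosure _ (in_tuple (r :: rs)) hcr hp k.
  by rewrite big_cons.
have hr1 : veq W 1 r by rewrite -[r](subrK 1) addrC; exact: veq_addr.
have powle a k : 1 <~ a -> 1 <~ a ^+ k by move=> h; rewrite -(expr1n _ k); exact: vle_exp.
apply: vclosure_closed => c Gc nc.
(* A power of each nonzero [a] in [rs] has the value of some [b] in [G], which is positive; by
   [arch] the powers of [b] pass the value of [c]. *)
have [k0 hk0] : eventually (fun k : nat => forall a, a \in rs -> c <~ a ^+ k).
  apply: (eventually_all 0%N) => a /hrs ha.
  have [a0|na] := eqVneq a 0.
    by exists 1%N => -[|k] // _; rewrite a0 expr0n; left.
  have [l [b [l0 Gb nb hb]]] := tors na.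
  have hb1 : 1 <! b.
    case: l l0 hb => // l _ hb; apply: (vlt_le_trans hW) hb.1.
    by rewrite exprS -[X in X <! _]mulr1; apply: vlt_mul => //; [apply: powle; exact: vltW | exact: oner_neq0].
  have [n hn] := arch Gb hb1 Gc nc.
  exists (l * n)%N => k; rewrite leEnat => hk.
  rewrite -(subnK hk) exprD -[c]mul1r; apply: vle_mul => //; first by apply: powle; exact: vltW.
  by apply: (vle_trans hW hn); rewrite exprM; apply: vle_exp => //; exact: hb.2.
(* The exponent must be positive: the terms [a ^+ 0 = 1] are not in the maximal ideal. *)
pose k := (maxn k0 1)%N.
have hk k' : (k <= k')%N -> veq W 1 (p k').
  move=> hkk; apply: (veq_trans hW (b := r ^+ k')).
    by rewrite -(expr1n _ k'); exact: veq_exp.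
  apply: veq_addr => //; apply: (vle_lt_trans hW (b := 1)).
    by rewrite -(expr1n _ k'); apply: vle_exp => //; case: hr1.
  rewrite big_seq; apply: vlt_sum => //; first exact: oner_neq0.
  move=> a ha; case: k' hkk => [|k'] hkk; first by rewrite /k geq_max andbF in hkk.
  rewrite exprS -[X in X <! _]mulr1; apply: vlt_mul => //; [exact: hrs | | exact: oner_neq0].
  by apply: powle; apply: vltW => //; exact: hrs.
have npk : p k != 0 by rewrite -(veq_eq0 (hk k (leqnn _))) oner_neq0.
exists (p k.+1 / p k); first by apply: (subringM hcr) => //; exact: hcV.
apply: vle_subC => //.
have -> : p k.+1 / p k - r = (\sum_(a <- rs) a ^+ k * (a - r)) / p k.
  rewrite -{1}[r](mulfK npk) -mulrBl; congr (_ / _).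
  under [RHS]eq_bigr => a _ do rewrite mulrBr -exprSr.
  rewrite sumrB -mulr_suml /p mulrDr -exprS opprD addrACA subrr add0r.
  by rewrite [r * _]mulrC.
apply/(vle_div hW) => //; apply: (vle_trans hW (b := c)).
  by rewrite -[X in _ <~ X]mulr1; apply: vle_mul => //; [exact: vle_refl | exact: (hk k (leqnn _)).2].
rewrite big_seq; apply: vle_sum => // a ha; rewrite -[c]mulr1; apply: vle_mul => //.
  by apply: hk0 => //; rewrite leEnat leq_maxl.
by apply: vle_sub => //; [apply: vltW => //; exact: hrs | case: hr1].
Qed.
End Closure.

(** * Dominating values exclude algebraic pseudo limits *)

Section AlgebraicContradiction.
Variables (E : fieldType) (W G F : E -> Prop) (d : Order.disp_t) (I : orderType d).
Variables (v : I -> E) (x : E) (i0 : I).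
Hypothesis hW : is_valuation_ring_of (fun _ => True) W.
Hypothesis hlim : forall i : I, exists j, (i < j)%O.
Hypothesis hinc : forall i i', (i < i')%O -> ~ vle W (x - v i') (x - v i).
Local Notation "a <~ b" := (vle W a b) (at level 70).
Local Notation "a <! b" := (~ vle W b a) (at level 70).

(** The field [F] carries the Hensel property and the polynomial [q] of least degree, while [G]
    carries the dominating values. A polynomial [g] over [G] approximates [q] on [W] with an error
    of value above that of [q(v i)] for large [i]. Hence a [y] dominating for [g] satisfies
    [val q(y) >= val q(v i)], against [minimal_polynomial_bound]. *)
Lemma no_algebraic_limit (s0 : seq E) a0 :
  is_subfield F ->
  (forall r rs, poly_over F (\prod_(a <- r :: rs) ('X - a%:P)) ->
     1 <! r - 1 -> (forall a, a \in rs -> 1 <! a) -> F r) ->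
  (forall y, G y -> F y) -> (forall i, F (v i)) -> (forall i, W (v i)) -> W x ->
  (forall y, F y -> ~ plim W v x y) ->
  (forall s, poly_over F (\prod_(a <- s) ('X - a%:P)) -> exists2 g, poly_over G g &
     eventually (fun i => forall u, W u ->
       \prod_(a <- s) (v i - a) <! g.[u] - \prod_(a <- s) (u - a))) ->
  (forall g, poly_over G g -> g != 0 -> exists y, [/\ G y, W y & g.[x] <~ g.[y]]) ->
  poly_over F (\prod_(a <- s0) ('X - a%:P)) -> a0 \in s0 -> ~ plim W v x a0.
Proof.
move=> hF hensel hGF hvF hvW hxW hno happrox hP2 hs0 ha0 hp0.
pose P n := `[< exists s : seq E, [/\ size s = n, poly_over F (\prod_(a <- s) ('X - a%:P))
   & exists2 a, a \in s & plim W v x a] >].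
have exP : exists n, P n by exists (size s0); apply/asboolP; exists s0; split=> //; exists a0.
case: (ex_minnP exP) => n /asboolP [s [<- hs [a1 ha1 hp1]]] hmin.
have {}hmin s' : poly_over F (\prod_(a <- s') ('X - a%:P)) ->
    (exists2 a, a \in s' & plim W v x a) -> (size s <= size s')%N.
  by move=> h1 h2; apply: hmin; apply/asboolP; exists s'.
have [g hg hgs] := happrox s hs.
have [j hj] := eventually_and hgs (eventually_and (prod_le_eventually i0 hW hlim hinc s)
                 (prod_neq0_eventually i0 hW hlim hinc s)).
(* For [g = 0] the error at [v j] would be [- q(v j)], whose value is not above that of [q(v j)]. *)
have ng : g != 0.
  have [h1 [_ h2]] := hj j (lexx _).
  apply: contraNneq h2 => g0; have := h1 _ (hvW j).
  rewrite g0 horner0 sub0r => h; exfalso; apply: h.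
  exact: (veq_opp hW _).2.
have [y [Gy Wy hy]] := hP2 g hg ng.
have [k hk] := minimal_polynomial_bound i0 hW hlim hinc hF hensel hvF hno hs ha1 hp1 hmin (hGF y Gy).
have [|h1 [h2 h3]] := hj (Order.max j k); first by rewrite le_max lexx.
have := hk (Order.max j k); apply; first by rewrite le_max lexx orbT.
move: (Order.max j k) h1 h2 h3 => i h1 h2 h3.
have hgy : \prod_(a <- s) (v i - a) <~ g.[y].
  apply: (vle_trans hW) hy; rewrite -[g.[x]](subrK (\prod_(a <- s) (x - a))).
  by apply: vle_add => //; apply: vltW => //; exact: h1.
rewrite -[X in _ <~ X](subKr g.[y]); apply: vle_sub => //.
by apply: vltW => //; exact: h1.
Qed.
End AlgebraicContradiction.

(** * Polynomials dominated by their constant term *)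

Section LeadingCoefficient.
Variables (E : fieldType) (W : E -> Prop).
Hypothesis hW : is_valuation_ring_of (fun _ => True) W.
Local Notation "a <~ b" := (vle W a b) (at level 70).
Local Notation "a <! b" := (~ vle W b a) (at level 70).

Lemma coef_prod_dominant (T : eqType) (s : seq T) (D : T -> E) c :
  (forall a, a \in s -> D a <! c) ->
  (\prod_(a <- s) ((D a)%:P + c *: 'X))`_0 = \prod_(a <- s) D a /\
  forall k, (0 < k)%N -> \prod_(a <- s) D a <! (\prod_(a <- s) ((D a)%:P + c *: 'X))`_k.
Proof.
elim: s => [|a s IH] hs.
  rewrite !big_nil coef1; split=> // -[//|k] _; rewrite coef1 /=.
  by move=> /vle_0x /eqP; rewrite oner_eq0.
have hDs b : b \in s -> D b <! c by move=> hb; apply: hs; rewrite inE hb orbT.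
have [IH0 IHk] := IH hDs; have ha : D a <! c by apply: hs; rewrite inE eqxx.
rewrite !big_cons; set P := \prod_(b <- s) (_ + _) in IH0 IHk *.
have nD : \prod_(b <- s) D b != 0.
  by rewrite prodf_seq_neq0; apply/allP => b /hDs; exact: vlt_neq0.
have eC k : (((D a)%:P + c *: 'X) * P)`_k = D a * P`_k + (if k is l.+1 then c * P`_l else 0).
  rewrite mulrDl coefD coefCM -scalerAl coefZ coefXM.
  by case: k => [|k] //=; rewrite mulr0.
rewrite eC addr0 IH0; split=> // -[//|k] _; rewrite eC; apply: vlt_add => //.
  by rewrite ![D a * _]mulrC; apply: vlt_mul => //; [exact: IHk | exact: vle_refl | exact: vlt_neq0 ha].
apply: vlt_mul => //; case: k => [|k]; first by rewrite IH0; exact: vle_refl.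
by apply: vltW => //; exact: IHk.
Qed.

Lemma horner_dominant (h : {poly E}) z : h`_0 != 0 -> (forall k, (0 < k)%N -> h`_0 <! h`_k) ->
  W z -> veq W h`_0 h.[z].
Proof.
move=> n0 hk hz; rewrite (horner_coef_wide _ (leqnSn (size h))) big_ord_recl expr0 mulr1.
apply: veq_addr => //; apply: vlt_sum => // k _ /=.
apply: (vlt_le_trans hW (hk (bump 0 k) _)) => //; rewrite -[X in X <~ _]mulr1.
apply: vle_mul => //; first exact: vle_refl.
by apply/(vring_ge1 hW); apply: subringX; case: hW.
Qed.
End LeadingCoefficient.

(** Coefficients are treated in turn: if [c q_n] is not in [V], its inverse is, and multiplying [c]
    by this inverse turns that coefficient into 1 and keeps the earlier ones in [V]. *)
Lemma clear_denominators (L : fieldType) (K V : L -> Prop) (q : {poly L}) :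
  is_subfield K -> is_valuation_ring_of K V -> poly_over K q ->
  exists c, [/\ K c, c != 0 & poly_over V (c *: q)].
Proof.
move=> [hKr hKV] [hVr [hVK hV]] hq.
have [c [Kc nc hc]] : exists c, [/\ K c, c != 0 & forall k, (k < size q)%N -> V (c * q`_k)].
  elim: (size q) => [|n [c [Kc nc IH]]].
    by exists 1; split=> //; [exact: subring1 | exact: oner_neq0].
  case: (pselect (V (c * q`_n))) => h.
    exists c; split=> // k; rewrite ltnS leq_eqVlt => /orP[/eqP -> //|]; exact: IH.
  have ne : c * q`_n != 0 by apply/eqP => e; apply: h; rewrite e; exact: subring0.
  have Kn : K (c * q`_n) by exact: subringM.
  have hV1 : V (c * q`_n)^-1 by case: (hV _ Kn ne).
  exists (c * (c * q`_n)^-1); split; first by apply: subringM => //; exact: hKV.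
    by rewrite mulf_neq0 // invr_eq0.
  move=> k; rewrite ltnS mulrAC leq_eqVlt => /orP[/eqP ->|hk].
    by rewrite divff //; exact: subring1.
  by apply: subringM => //; exact: IH.
exists c; split=> // k; rewrite coefZ; case: (ltnP k (size q)) => hk; first exact: hc.
by rewrite nth_default // mulr0; exact: subring0.
Qed.

Definition image_of (L E : fieldType) (iota : L -> E) (K : L -> Prop) b := exists2 a, K a & b = iota a.

Section ImageSubfield.
Variables (L E : fieldType) (iota : {rmorphism L -> E}) (K : L -> Prop).
Hypothesis hK : is_subfield K.

Lemma image_subfield : is_subfield (image_of iota K).
Proof.
have [hKr hKV] := hK; split; first split.
- by exists 1; [exact: subring1 | rewrite rmorph1].
- split=> _ _ [a ha ->] [b hb ->].
    by exists (a - b); [exact: subringB | rewrite rmorphB].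
  by exists (a * b); [exact: subringM | rewrite rmorphM].
by move=> _ [a ha ->]; exists a^-1; [exact: hKV | rewrite fmorphV].
Qed.

Lemma poly_over_image q : poly_over K q -> poly_over (image_of iota K) (map_poly iota q).
Proof. by move=> hq k; exists q`_k => //; rewrite coef_map. Qed.

Lemma poly_over_imageP g : poly_over (image_of iota K) g ->
  exists2 q, poly_over K q & g = map_poly iota q.
Proof.
move=> hg; have hex k : exists a, K a /\ g`_k = iota a by have [a ha e] := hg k; exists a.
have [f hf] := choice hex.
exists (\poly_(k < size g) f k).
  move=> k; rewrite coef_poly; case: ifP => _; first by case: (hf k).
  exact: (subring0 hK.1).
apply/polyP => k; rewrite coef_map coef_poly; case: ltnP => hk; first by case: (hf k).
by rewrite /= nth_default // rmorph0.
Qed.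
End ImageSubfield.

(** * Immediate extensions *)

Section Immediate.
Variables (L : fieldType) (K V V' : L -> Prop) (d : Order.disp_t) (I : orderType d).
Variables (v : I -> L) (x : L).
Hypothesis hK : is_subfield K.
Hypothesis hV : is_valuation_ring_of K V.
Hypothesis hV' : is_valuation_ring_of (fun _ => True) V'.
Hypothesis himm : immediate_extension K V V'.
Hypothesis hI : exists i : I, True.
Hypothesis hlim : forall i : I, exists j, (i < j)%O.
Hypothesis hvV : forall i, V (v i).
Hypothesis hpc : pseudo_convergent V v.
Hypothesis hxV' : V' x.
Hypothesis hxlim : pseudo_limit V' v x.
Hypothesis htr : transcendental_over K x.
Local Notation "a <~ b" := (vle V' a b) (at level 70).
Local Notation "a <! b" := (~ vle V' b a) (at level 70).

Let hKr : is_subring K. Proof. by case: hK. Qed.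
Let hVr : is_subring V. Proof. by case: hV. Qed.
Let hV'r : is_subring V'. Proof. by case: hV'. Qed.
Let hVK a : V a -> K a. Proof. by case: hV => _ [h _]; exact: h. Qed.
Let hVV' a : K a -> (V a <-> V' a). Proof. by case: himm => h _; exact: h. Qed.
Let hVV a : V a -> V' a. Proof. by move=> h; apply/hVV' => //; exact: hVK. Qed.
Let hvK i : K (v i). Proof. by apply: hVK; exact: hvV. Qed.
Let Kdiv a b : K a -> K b -> K (a / b).
Proof. by move=> ha hb; apply: subringM => //; exact: hK.2. Qed.

Lemma vle_base a b : K a -> K b -> (vle V a b <-> a <~ b).
Proof.
move=> ha hb; have hd := Kdiv hb ha.
by rewrite /vle; split=> -[h|[na h]]; [by left | right; split=> //; exact/hVV'
  | by left | right; split=> //; exact/hVV'].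
Qed.
Lemma veq_base a b : K a -> K b -> (veq V a b <-> veq V' a b).
Proof. by move=> ha hb; rewrite /veq !vle_base. Qed.

Lemma base_value a : a != 0 -> exists b, [/\ K b, b != 0 & veq V' a b].
Proof. by move=> /himm.2.1 [b [h1 [h2 h3]]]; exists b. Qed.

(** Both distances are read off at a third index [j] beyond [i'], where pseudo convergence compares
    them. *)
Lemma distance_increasing i i' : (i < i')%O -> x - v i <! x - v i'.
Proof.
move=> hii'; have [j hj] := hlim i'.
have [_ h] := hpc hii' hj.
have h' : v i - v j <! v i' - v j by move=> /vle_base h2; apply: h; apply: h2; exact: subringB.
apply: (vle_lt_trans hV' (hxlim (lt_trans hii' hj)).1).
exact: (vlt_le_trans hV' h' (hxlim hj).2).
Qed.

Lemma plim_pseudo_limit y : plim V' v x y -> pseudo_limit V' v y.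
Proof.
move=> hy i i' hii'.
apply: (veq_trans hV' (veq_subC hV' _ _)).
by apply: (veq_trans hV' (veq_sub_plim hV' hlim distance_increasing i hy)); exact: hxlim.
Qed.

(** * Values of a polynomial along the sequence, through its roots *)

Section Extension.
Variables (E : fieldType) (iota : {rmorphism L -> E}) (W : E -> Prop) (s : seq E) (f : {poly L}).
Hypothesis hW : is_valuation_ring_of (fun _ => True) W.
Hypothesis hWV' : forall a, W (iota a) <-> V' a.
Hypothesis nf : f != 0.
Hypothesis fs : map_poly iota f = iota (lead_coef f) *: \prod_(a <- s) ('X - a%:P).

Lemma distance_increasing_map i i' : (i < i')%O ->
  ~ vle W (iota x - iota (v i')) (iota x - iota (v i)).
Proof. by move=> h; rewrite -!rmorphB (vle_map hWV'); exact: distance_increasing. Qed.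

Lemma horner_map_roots a : iota f.[a] = iota (lead_coef f) * \prod_(b <- s) (iota a - b).
Proof. by rewrite -horner_map fs hornerZ horner_prodXsub. Qed.

Let nlc : iota (lead_coef f) != 0. Proof. by rewrite fmorph_eq0 lead_coef_eq0. Qed.

Lemma value_stable_of_no_limit : (forall a, a \in s -> ~ plim W (iota \o v) (iota x) a) ->
  eventually (fun i => forall i', (i < i')%O -> veq V' f.[v i] f.[v i']).
Proof.
move=> hno; have [i0 _] := hI.
have [j hj] := root_behaviour_eventually i0 hW hlim distance_increasing_map s.
have hx i : (j <= i)%O -> veq W (iota f.[v i]) (iota f.[x]).
  move=> hji; rewrite !horner_map_roots; apply: veq_mul => //; first exact: veq_refl.
  apply: veq_prod => // a ha _; apply: (veq_sub_nonlimit (v := iota \o v)) => //.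
  exact: (hj i hji a ha).2 (hno a ha).
exists j => i hji i' hii'; apply/(veq_map hWV').
apply: (veq_trans hW (hx i hji)); apply: veq_sym; apply: hx.
exact: le_trans hji (ltW hii').
Qed.

(** A root that is a pseudo limit makes the value of [f(v i)] eventually strictly increasing.
    Denominators are cleared first, since [transcendental_seq] only speaks of polynomials over
    [V]. *)
Lemma no_limit_of_transcendental : poly_over K f -> transcendental_seq V v ->
  forall a, a \in s -> ~ plim W (iota \o v) (iota x) a.
Proof.
move=> hf ht a ha hp; have [i0 _] := hI.
have [c [Kc nc hc]] := clear_denominators hK hV hf.
have [j hj] := ht _ hc.
have [k hk] := prod_lt_eventually i0 hW hlim distance_increasing_map ha hp.
have [i] := hlim (Order.max j k); rewrite gt_max => /andP[hji hki].
have [i' hii'] := hlim i.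
have [_] := hj i i' (ltW hji) hii'; rewrite !hornerZ.
have Kf l : K f.[v l] by exact: poly_over_horner.
rewrite vle_base; try exact: subringM.
rewrite (vle_pmul2l hV' _ _ nc) -(vle_map hWV') !horner_map_roots (vle_pmul2l hW _ _ nlc).
exact: hk (ltW hki) i' hii'.
Qed.
End Extension.

(* For large [i] the Taylor expansion of [q] at [v i], rescaled to the radius
   [val (x - v i)], is dominated by its constant term. *)
Lemma taylor_dominant q : transcendental_seq V v -> poly_over K q -> q != 0 ->
  eventually (fun i => q.[v i] != 0 /\ forall c, veq V' c (x - v i) ->
    (q \Po ((v i)%:P + c *: 'X))`_0 = q.[v i] /\
    forall k, (0 < k)%N -> q.[v i] <! (q \Po ((v i)%:P + c *: 'X))`_k).
Proof.
move=> ht hq nq; have [i0 _] := hI.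
have [E [iota [W [s [hW hWV' _ fs]]]]] := splitting_valuation_extension hV' nq (leqnn _).
have hno := no_limit_of_transcendental hW hWV' nq fs hq ht.
have hinc := distance_increasing_map hWV'.
have [j hj] := eventually_and (root_behaviour_eventually i0 hW hlim hinc s)
                 (prod_neq0_eventually i0 hW hlim hinc s).
have nlc : iota (lead_coef q) != 0 by rewrite fmorph_eq0 lead_coef_eq0.
exists j => i /hj [hroot nprod]; split.
  by rewrite -(fmorph_eq0 iota) (horner_map_roots fs) mulf_neq0.
move=> c hc.
(* No root is a pseudo limit, so [v i - a] has the value of [x - a], below that of [x - v i] and
   hence of [c]. *)
have hlt a : a \in s -> ~ vle W (iota c) (iota (v i) - a).
  move=> ha; have h1 := (hroot a ha).2 (hno a ha).
  have h2 : veq W (iota c) (iota x - iota (v i)) by rewrite -rmorphB; apply/(veq_map hWV').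
  apply: (vle_lt_trans hW (veq_sub_nonlimit (v := iota \o v) hW h1).1).
  exact: (vlt_le_trans hW h1 h2.2).
have [h0 hk] := coef_prod_dominant hW hlt.
have ecoef k : iota (q \Po ((v i)%:P + c *: 'X))`_k = iota (lead_coef q) *
    (\prod_(a <- s) ((iota (v i) - a)%:P + iota c *: 'X))`_k.
  rewrite -coef_map -coefZ; suff -> : map_poly iota (q \Po ((v i)%:P + c *: 'X)) =
    iota (lead_coef q) *: \prod_(a <- s) ((iota (v i) - a)%:P + iota c *: 'X) by [].
  rewrite map_comp_poly fs comp_polyZ rmorph_prod; congr (_ *: _); apply: eq_bigr => a _ /=.
  rewrite comp_polyB comp_polyX comp_polyC [map_poly _ _]rmorphD /= map_polyC map_polyZ map_polyX.
  by rewrite polyCB addrAC.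
have e0 : (q \Po ((v i)%:P + c *: 'X))`_0 = q.[v i].
  by apply: (fmorph_inj iota); rewrite ecoef h0 (horner_map_roots fs).
split=> // k hk0; rewrite -(vle_map hWV') ecoef (horner_map_roots fs) (vle_pmul2l hW _ _ nlc).
exact: hk.
Qed.

Lemma step_value i i' : (i < i')%O ->
  [/\ K (v i' - v i), v i' - v i != 0, veq V' (v i' - v i) (x - v i)
    & V' ((x - v i) / (v i' - v i))].
Proof.
move=> hii'.
have h : veq V' (v i' - v i) (x - v i).
  by apply: (veq_trans hV' (veq_subC hV' _ _)); apply: veq_sym; exact: hxlim.
have n : v i' - v i != 0 by rewrite (veq_eq0 h); exact: sub_neq0 hlim distance_increasing i.
by split=> //; [exact: subringB | apply/(vleE hV') => //; case: h].
Qed.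

(** Here [h] is the Taylor expansion of [q] at [v i], rescaled by [v i' - v i] and divided by
    [q(v i)]. Its constant term is 1 and its other coefficients lie in the maximal ideal, so it
    takes unit values on [V']. *)
Lemma transcendental_unit_factor q : transcendental_seq V v -> poly_over K q -> q != 0 ->
  eventually (fun i => forall i', (i < i')%O -> exists h, [/\ poly_over V h, q.[v i] != 0,
    veq V' 1 h.[(x - v i) / (v i' - v i)] &
    q.[x] = q.[v i] * h.[(x - v i) / (v i' - v i)]]).
Proof.
move=> ht hq nq; apply: eventually_mono (taylor_dominant ht hq nq) => i [nqi hi] i' hii'.
have [Kc nc hc Vz] := step_value hii'.
have {hi} [e0 hk] := hi _ hc.
set g := q \Po _ in e0 hk.
have Kg : poly_over K g.
  apply: poly_over_comp => //; apply: poly_overD => //; first exact: poly_overC.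
  by apply: poly_overZ => //; exact: poly_overX.
have Kqi : K q.[v i] by exact: poly_over_horner.
exists (q.[v i]^-1 *: g); split=> //.
- move=> k; rewrite coefZ; apply/hVV'; first by apply: subringM => //; exact: hK.2.
  rewrite mulrC; apply/(vleE hV') => //; case: k => [|k]; first by rewrite e0; exact: vle_refl.
  by apply: vltW => //; exact: hk.
- rewrite hornerZ mulrC -(divff nqi) -{1}e0; apply: veq_mul => //; last exact: veq_refl.
  by apply: horner_dominant; rewrite ?e0.
rewrite hornerZ mulVKf // /g horner_comp hornerD hornerC hornerZ hornerX.
by rewrite mulrCA divff // mulr1 addrC subrK.
Qed.

Lemma transcendental_values : transcendental_seq V v ->
  forall f : {poly L}, poly_over V f -> f.[x] != 0 -> exists y, V y /\ veq V' f.[y] f.[x].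
Proof.
move=> ht f hf nfx.
have nf : f != 0 by apply: contraNneq nfx => ->; rewrite horner0.
have hfK : poly_over K f by move=> k; exact: hVK.
have [i hi] := transcendental_unit_factor ht hfK nf; have [i' hii'] := hlim i.
have [h [_ _ h1 ->]] := hi i (lexx _) i' hii'.
exists (v i); split=> //; rewrite -{1}[f.[v i]]mulr1; apply: veq_mul => //.
exact: veq_refl.
Qed.

(** The generators are [z = (x - v i) / (v i' - v i)] for [i < i']; a larger first index gives a
    larger localization. Every fraction [g(x) / h(x)] becomes an element of [K] times a quotient of
    two polynomials over [V] that are units at a suitable [z]. *)
Lemma transcendental_filtered_union : generated_by K x -> transcendental_seq V v ->
  filtered_union_loc_poly V V'.
Proof.
move=> hgen ht.
pose J := {p : I * I | (p.1 < p.2)%O}.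
pose c (p : J) := v (sval p).2 - v (sval p).1.
pose z (p : J) := (x - v (sval p).1) / c p.
have hlt (p : J) : ((sval p).1 < (sval p).2)%O by exact: (svalP p).
have hstep p := step_value (hlt p).
exists J, z; split; first by move=> p; case: (hstep p).
split.
  move=> p q hq nq; have [Kc nc _ _] := hstep p.
  pose l := (c p)^-1 *: ('X - (v (sval p).1)%:P).
  have -> : q.[z p] = (q \Po l).[x].
    by rewrite horner_comp /l hornerZ hornerXsubC mulrC.
  apply: htr.
    apply: poly_over_comp => //; first by move=> k; exact: hVK.
    apply: poly_overZ => //; first exact: hK.2.
    by apply: poly_overB => //; [exact: poly_overX | exact: poly_overC].
  apply: contraNneq nq => e.
  (* The affine substitution [l] is invertible, so it does not kill [q]. *)
  have -> : q = (q \Po l) \Po (c p *: 'X + (v (sval p).1)%:P).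
    rewrite -comp_polyA /l comp_polyZ comp_polyB comp_polyX comp_polyC addrK.
    by rewrite scalerA mulVf // scale1r comp_polyXr.
  by rewrite e comp_poly0.
split.
  have [i _] := hI; have [i' hii'] := hlim i.
  by exists (exist _ (i, i') hii').
have hincl (p p' : J) : ((sval p).1 < (sval p').1)%O ->
    forall a, loc_poly_subalg V V' (z p) a -> loc_poly_subalg V V' (z p') a.
  move=> hpp' a [g [h [hg [hh [h1 [h2 ->]]]]]].
  have [Kc nc hc _] := hstep p; have [Kc' nc' hc' _] := hstep p'.
  have [K1 n1 h3 _] := step_value hpp'.
  (* From [x - v i = (v j - v i) + (x - v j)], with [i] and [j] the first indices of [p] and [p'],
     [z p] is affine in [z p']. The coefficients lie in [V] because [c p] has the value of
     [x - v i], which is also that of [v j - v i] and is below that of [c p']. *)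
  pose l := ((v (sval p').1 - v (sval p).1) / c p)%:P + (c p' / c p) *: 'X.
  have hl : poly_over V l.
    apply: poly_overD => //.
      apply: poly_overC => //; apply/hVV'; first exact: Kdiv.
      by apply/(vleE hV') => //; apply: (vle_trans hV' hc.1); case: h3.
    apply: poly_overZ => //; last exact: poly_overX.
    apply/hVV'; first exact: Kdiv.
    apply/(vleE hV') => //; apply: (vle_trans hV' hc.1); apply: (vle_trans hV') hc'.2.
    by apply: vltW => //; exact: distance_increasing.
  have el : l.[z p'] = z p.
    rewrite /l hornerD hornerC hornerZ hornerX /z mulrAC [c p' * _]mulrC mulfVK //.
    by rewrite -mulrDl addrC addrA subrK.
  exists (g \Po l), (h \Po l); rewrite !horner_comp el.
  by split; [exact: poly_over_comp | split; [exact: poly_over_comp | ]].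
split.
  move=> p p'; have [i] := hlim (Order.max (sval p).1 (sval p').1).
  rewrite gt_max => /andP[h1 h2]; have [i' hii'] := hlim i.
  by exists (exist _ (i, i') hii'); split; exact: hincl.
move=> a; split; last first.
  move=> [p [g [h [hg [hh [h1 [h2 ->]]]]]]].
  have [_ _ _ Vz] := hstep p.
  have hu : veq V' 1 h.[z p] by apply/(vunitE hV').
  have nh : h.[z p] != 0 by rewrite -(veq_eq0 hu) oner_neq0.
  apply/(vleE hV') => //; apply: (vle_trans hV' hu.2); apply/(vring_ge1 hV').
  by apply: poly_over_horner => // k; apply: hVV; exact: hg.
move=> Va; have [g [h [hg [hh [nhx ea]]]]] := hgen a.
have [p0 _] : exists p : J, True.
  by have [i _] := hI; have [i' hii'] := hlim i; exists (exist _ (i, i') hii').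
(* Zero is separated because the unit factorization needs a nonzero numerator. *)
have [a0|na] := eqVneq a 0.
  exists p0, 0, 1%:P; rewrite !hornerC a0 mul0r; split; first exact: poly_over0.
  split; first by apply: poly_overC => //; exact: subring1.
  by have [? ?] := (vunitE hV' 1).2 (veq_refl hV' 1).
have nh : h != 0 by apply: contraNneq nhx => ->; rewrite horner0.
have ng : g != 0 by apply: contraNneq na => g0; rewrite ea g0 horner0 mul0r.
have [i hi] := eventually_and (transcendental_unit_factor ht hg ng)
                              (transcendental_unit_factor ht hh nh).
have [i' hii'] := hlim i; have [h1 h2] := hi i (lexx _).
have [g1 [Vg1 ng1 ug1 eg1]] := h1 i' hii'.
have [h3 [Vh3 nh3 uh3 eh3]] := h2 i' hii'.
exists (exist _ (i, i') hii'), ((g.[v i] / h.[v i]) *: g1), h3.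
have Kgh : K (g.[v i] / h.[v i]) by apply: Kdiv; exact: poly_over_horner.
have eagh : a = (g.[v i] / h.[v i]) * (g1.[z (exist _ (i, i') hii')] / h3.[z (exist _ (i, i') hii')]).
  by rewrite ea eg1 eh3 invfM mulrACA.
split.
  (* The quotient of [g1] and [h3] at [z] is a unit, so the scalar has the value of [a] and lies in
     [V]. *)
  apply: poly_overZ => //; apply/hVV' => //; apply/(vring_ge1 hV').
  move/(vring_ge1 hV'): Va => Va; apply: (vle_trans hV' Va).
  rewrite eagh -[X in _ <~ X]mulr1; apply: vle_mul => //; first exact: vle_refl.
  have nu : h3.[z (exist _ (i, i') hii')] != 0 by rewrite -(veq_eq0 uh3) oner_neq0.
  by apply/(vle_divl hV') => //; rewrite mul1r; apply: (vle_trans hV' ug1.2); case: uh3.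
split=> //; have [u1 u2] := (vunitE hV' _).2 uh3; split=> //; split=> //.
by rewrite hornerZ -mulrA.
Qed.

(** * From a filtered union of localizations back to values on [V] *)

Lemma horner_congruent p z u : poly_over V' p -> V' z -> 1 <! z - u -> 1 <! p.[z] - p.[u].
Proof.
move=> hp hz hzu.
have hu : V' u.
  rewrite -[u](subKr z); apply: subringB => //; apply/(vring_ge1 hV'); exact: vltW.
rewrite (horner_coef_wide _ (leqnn _)) (horner_coef_wide u (leqnn _)) -sumrB.
apply: vlt_sum => //; first exact: oner_neq0.
move=> k _; rewrite -mulrBr subrXX mulrCA; apply: (vlt_le_trans hV' hzu).
rewrite -[X in X <~ _]mulr1; apply: vle_mul => //; first exact: vle_refl.
apply/(vring_ge1 hV'); apply: subringM => //; apply: subring_sum => // j _.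
by apply: subringM => //; exact: subringX.
Qed.

(** This is [q ^+ size f] times [f(p / q)], free of denominators. The exponent exceeds the degree by
    one, which is harmless because [q] will be evaluated where it is a unit. *)
Definition homogenize (f p q : {poly L}) :=
  \sum_(k < size f) f`_k *: (p ^+ k * q ^+ (size f - k)).

Lemma horner_homogenize f p q t : q.[t] != 0 ->
  (homogenize f p q).[t] = f.[p.[t] / q.[t]] * q.[t] ^+ size f.
Proof.
move=> nq; rewrite /homogenize horner_sum horner_coef mulr_suml; apply: eq_bigr => k _.
rewrite hornerZ hornerM !horner_exp expr_div_n -!mulrA; congr (_ * (_ * _)).
by apply: (mulfI (expf_neq0 k nq)); rewrite mulVKf ?expf_neq0 // -exprD subnKC // ltnW.
Qed.

(* Reducing [z] modulo the maximal ideal to some [u] in [V] gives a retraction of the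
   localization of [V[z]] onto [V], which preserves units. *)
Lemma filtered_union_values : filtered_union_loc_poly V V' ->
  forall f : {poly L}, poly_over V f -> f.[x] != 0 -> exists y, V y /\ veq V' f.[y] f.[x].
Proof.
move=> [J [z [hz [htz [_ [hdir hun]]]]]] f hf nfx.
(* Write [f(x) = c w] with [c] in [V] and [w] a unit of [V']; directedness then presents both [x]
   and [w] as fractions over one [V[z l]]. *)
have [c [Kc nc hc]] := base_value nfx.
have Vfx : V' f.[x] by apply: poly_over_horner => // k; apply: hVV; exact: hf.
have Vc : V c.
  apply/hVV' => //; apply/(vring_ge1 hV'); apply: (vle_trans hV') hc.1; exact/(vring_ge1 hV').
have [j hj] := (hun x).1 hxV'.
have hw : veq V' 1 (f.[x] / c).
  by rewrite -(divff nc); apply: veq_mul => //; [exact: veq_sym | exact: veq_refl].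
have [k hk] := (hun (f.[x] / c)).1 ((vunitE hV' _).2 hw).1.
have [l [hjl hkl]] := hdir j k.
have [p1 [q1 [Vp1 [Vq1 [wq1 [mq1 ex]]]]]] := hjl _ hj.
have [p2 [q2 [Vp2 [Vq2 [wq2 [mq2 ew]]]]]] := hkl _ hk.
have uq1 : veq V' 1 q1.[z l] by apply/(vunitE hV').
have uq2 : veq V' 1 q2.[z l] by apply/(vunitE hV').
have unz (a : L) : veq V' 1 a -> a != 0 by move=> h; rewrite -(veq_eq0 h) oner_neq0.
have up2 : veq V' 1 p2.[z l].
  have -> : p2.[z l] = (f.[x] / c) * q2.[z l] by rewrite ew mulfVK // unz.
  by rewrite -[X in veq _ X _]mulr1; exact: veq_mul.
have [u [Vu /(maxidE hV') hu]] := himm.2.2 _ (hz l).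
have ured q : poly_over V q -> veq V' 1 q.[z l] -> veq V' 1 q.[u].
  move=> hq h; apply: (veq_trans hV' h); rewrite -[q.[u]](subKr q.[z l]).
  apply: veq_subr => //; apply: (vle_lt_trans hV' h.2).
  by apply: horner_congruent => // m; apply: hVV; exact: hq.
have uq1u := ured _ Vq1 uq1; have uq2u := ured _ Vq2 uq2; have up2u := ured _ Vp2 up2.
(* [D] clears denominators in [c w = f(x)]. It vanishes at the transcendental [z l], so it is zero,
   and evaluating it at [u] gives the corresponding identity for [y = p1[u] / q1[u]], in which [c]
   is still multiplied by a unit. *)
pose D := c *: (p2 * q1 ^+ size f) - q2 * homogenize f p1 q1.
have VD : poly_over V D.
  apply: poly_overB => //.
    by apply: poly_overZ => //; apply: poly_overM => //; exact: poly_over_exp.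
  apply: poly_overM => //; apply: poly_over_sum => // m _; apply: poly_overZ => //.
  by apply: poly_overM => //; exact: poly_over_exp.
have eD t : q1.[t] != 0 ->
    D.[t] = (c * p2.[t] - q2.[t] * f.[p1.[t] / q1.[t]]) * q1.[t] ^+ size f.
  move=> nq; rewrite /D hornerD hornerN hornerZ !hornerM horner_exp horner_homogenize //.
  by rewrite mulrBl !mulrA.
have D0 : D = 0.
  apply: contrapT => /eqP nD; have /eqP := htz l _ VD nD; apply.
  rewrite eD; last exact: unz.
  have -> : c * p2.[z l] = q2.[z l] * f.[x].
    by rewrite -[f.[x]](mulfVK nc) ew mulrCA mulrC mulrA mulfVK // unz.
  by rewrite -ex subrr mul0r.
exists (p1.[u] / q1.[u]); split.
  apply/hVV'; first by apply: Kdiv; apply: hVK; exact: poly_over_horner.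
  apply/(vleE hV'); first exact: unz.
  apply: (vle_trans hV' uq1u.2); apply/(vring_ge1 hV'); apply: hVV; exact: poly_over_horner.
have := eD u (unz _ uq1u); rewrite D0 horner0 => /esym/eqP.
rewrite mulf_eq0 expf_eq0 (negbTE (unz _ uq1u)) andbF orbF subr_eq0 => /eqP e.
apply: (veq_trans hV' _ (veq_sym hc)).
apply: (veq_trans hV' (b := q2.[u] * f.[p1.[u] / q1.[u]])).
  by rewrite -[X in veq _ X _]mul1r; apply: veq_mul => //; exact: veq_refl.
rewrite -e -[X in veq _ _ X]mulr1; apply: veq_mul => //; first exact: veq_refl.
exact: veq_sym.
Qed.

(** * No root of a polynomial over the base is a pseudo limit *)

Section AlgebraicCase.
Variables (E : fieldType) (iota : {rmorphism L -> E}) (W : E -> Prop) (s : seq E) (f : {poly L}).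
Hypothesis hW : is_valuation_ring_of (fun _ => True) W.
Hypothesis hWV' : forall a, W (iota a) <-> V' a.
Hypothesis htors : torsion_over iota W.
Hypothesis hnolim : forall y, K y -> ~ pseudo_limit V' v y.
Hypothesis hf : poly_over K f.
Hypothesis nf : f != 0.
Hypothesis fs : map_poly iota f = iota (lead_coef f) *: \prod_(a <- s) ('X - a%:P).
Hypothesis hP2 : forall g : {poly L}, poly_over V g -> g.[x] != 0 ->
  exists y, V y /\ vle V' g.[x] g.[y].
Local Notation G := (image_of iota K).
Local Notation "a <~W b" := (vle W a b) (at level 70).
Local Notation "a <!W b" := (~ vle W b a) (at level 70).
Let hG : is_subfield G. Proof. exact: image_subfield. Qed.
Let hW1 : is_subring W. Proof. by case: hW. Qed.
Let hinc i i' : (i < i')%O -> iota x - iota (v i) <!W iota x - iota (v i').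
Proof. by move/(distance_increasing_map hWV'). Qed.

Lemma dominating_base_point g : poly_over G g -> g != 0 ->
  exists y, [/\ G y, W y & g.[iota x] <~W g.[y]].
Proof.
move=> /(poly_over_imageP hK) [g0 Kg0 ->]; rewrite map_poly_eq0 => ng0.
have [c [Kc nc Vg]] := clear_denominators hK hV Kg0.
have [|y [Vy hy]] := hP2 Vg.
  by rewrite hornerZ mulf_neq0 // htr.
exists (iota y); split; first by exists y => //; exact: hVK.
  by apply/hWV'; exact: hVV.
rewrite !horner_map; apply/(vle_map hWV'); apply/(vle_pmul2l hV' _ _ nc).
by rewrite -!hornerZ.
Qed.

Lemma base_no_plim y : G y -> ~ plim W (iota \o v) (iota x) y.
Proof.
move=> [b Kb ->] h; apply: (hnolim Kb); apply: plim_pseudo_limit => i.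
by apply/(vle_map hWV'); rewrite !rmorphB; exact: h.
Qed.

(** The product descends to a monic [B] over [V] for which 1 is a simple root modulo the maximal
    ideal: [B(1)] has the factor [1 - r], and [B'(1)] is congruent to the unit [prod (1 - a)]. The
    lifted root is congruent to 1, so it is none of the [rs] and equals [r]. *)
Lemma henselian_base r rs : henselian V -> poly_over G (\prod_(a <- r :: rs) ('X - a%:P)) ->
  1 <!W r - 1 -> (forall a, a \in rs -> 1 <!W a) -> G r.
Proof.
move=> hens hp hr hrs.
have hr1 : veq W 1 r by rewrite -[r](subrK 1) addrC; exact: veq_addr.
have [B KB eB] := poly_over_imageP hK hp.
have WB : poly_over W (\prod_(a <- r :: rs) ('X - a%:P)).
  apply: poly_over_prodXsub => // a; rewrite inE => /orP[/eqP ->|/hrs ha].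
    by apply/(vring_ge1 hW); case: hr1.
  by apply/(vring_ge1 hW); exact: vltW.
have VB : poly_over V B.
  by move=> k; apply/hVV' => //; apply/hWV'; rewrite -coef_map -eB.
have mB : B \is monic.
  by rewrite -(map_monic iota) -eB monic_prod // => a _; exact: monicXsubC.
have maxV a : K a -> maxid V a <-> 1 <!W iota a.
  move=> Ka; rewrite (maxid_base hV' hK hVK hVV') -(rmorph1 iota) (vle_map hWV').
  by split=> [[]|].
have u1 a : 1 <!W a -> veq W 1 (1 - a) by move=> h; exact: veq_subr.
have uP : veq W 1 (\prod_(a <- rs) (1 - a)).
  have e1 : 1 = \prod_(a <- rs) (1 : E) by rewrite big1_eq.
  rewrite [X in veq W X _]e1.
  by apply: veq_prod => // a ha _; apply: u1; exact: hrs.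
have h1r : 1 <!W 1 - r by rewrite -opprB; exact: vlt_oppr.
have K1 : K 1 by exact: subring1.
have [||b [Vb [rb hb]]] := hens B VB mB 1 (subring1 hVr).
- apply/maxV; first exact: poly_over_horner.
  rewrite -horner_map rmorph1 -eB horner_prodXsub big_cons -[X in X <!W _]mulr1.
  by apply: vlt_mul => //; [case: uP | exact: oner_neq0].
- move/maxV => h; have {}h := h (poly_over_horner hKr (poly_over_deriv hKr KB) K1).
  apply: h; rewrite -horner_map rmorph1 -deriv_map -eB big_cons derivM derivXsubC mul1r.
  rewrite hornerD hornerM hornerXsubC horner_prodXsub.
  have WC : poly_over W (\prod_(a <- rs) ('X - a%:P)).
    by apply: poly_over_prodXsub => // a /hrs ha; apply/(vring_ge1 hW); exact: vltW.
  set C' := (_^`()).[1].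
  have WC' : W C' by apply: poly_over_horner => //; [exact: poly_over_deriv | exact: subring1].
  have hlt : \prod_(a <- rs) (1 - a) <!W (1 - r) * C'.
    apply: (vle_lt_trans hW uP.2); rewrite -[X in X <!W _]mulr1.
    by apply: vlt_mul => //; [exact/(vring_ge1 hW) | exact: oner_neq0].
  exact: (vle_trans hW (veq_addr hW hlt).2 uP.2).
have Kb := hVK Vb.
have : root (\prod_(a <- r :: rs) ('X - a%:P)) (iota b).
  by rewrite eB rootE horner_map rb rmorph0.
rewrite root_prod_XsubC inE => /orP[/eqP <-|/hrs h]; first by exists b.
move/maxV: hb => /(_ (subringB hKr Kb K1)); rewrite rmorphB rmorph1 => h2.
exfalso; have := vlt_sub hW h h2; rewrite subKr; apply; exact: vle_refl.
Qed.

Lemma no_limit_henselian a : henselian V -> a \in s -> ~ plim W (iota \o v) (iota x) a.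
Proof.
move=> hens; have [i0 _] := hI; have [hGr hGV] := hG.
apply: (no_algebraic_limit (F := G) (G := G) i0 hW hlim hinc) => //.
- by move=> r rs; exact: henselian_base.
- by move=> i; exists (v i).
- by move=> i; apply/hWV'; exact: hVV.
- exact/hWV'.
- exact: base_no_plim.
(* Since [F] and [G] coincide, the polynomial approximates itself with zero error. *)
- move=> s' hs'; exists (\prod_(b <- s') ('X - b%:P)) => //.
  apply: eventually_mono (prod_neq0_eventually i0 hW hlim hinc s') => i hi u _.
  by rewrite horner_prodXsub subrr => /vle_0x h; rewrite h eqxx in hi.
- exact: dominating_base_point.
have -> : \prod_(b <- s) ('X - b%:P) = (iota (lead_coef f))^-1 *: map_poly iota f.
  by rewrite fs scalerA mulVf ?scale1r // fmorph_eq0 lead_coef_eq0.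
apply: poly_overZ => //; last exact: poly_over_image.
by apply: hGV; exists (lead_coef f) => //; exact: hf.
Qed.

(** If fundamentality fails at [c], arbitrarily late differences have value at most that of [c];
    they have the values of later distances to [x], which bound the earlier ones. *)
Lemma not_fundamental_bound : ~ fundamental K V v ->
  exists c, [/\ K c, c != 0 & forall i, x - v i <~ c].
Proof.
move=> /existsNP [c /not_implyP [Kc /not_implyP [nc /forallNP h]]].
exists c; split=> // i.
have /existsNP [j /existsNP [j' /not_implyP [hij /not_implyP [hjj' hn]]]] := h i.
have Kj : K (v j - v j') by exact: subringB.
have hjc : v j - v j' <~ c.
  apply/vle_base => //; apply: contrapT => h2; apply: hn; split=> //.
  by apply/vle_base => //; apply: (vltW hV') => h3; apply: h2; apply/vle_base.
apply: (vle_trans hV') hjc; apply: (vle_trans hV') (hxlim hjj').1.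
move: hij; rewrite le_eqVlt => /orP[/eqP <-|hij]; first exact: vle_refl.
by apply: vltW => //; exact: distance_increasing.
Qed.

(** The field [F] is the closure of the image of [K]. The bound [c] on the distances to [x] makes
    finite precision enough, both to move a pseudo limit from the closure into [K] and to replace a
    polynomial over the closure by one over [K]. *)
Lemma no_limit_dim_one a : krull_dim_one V -> ~ fundamental K V v -> a \in s ->
  ~ plim W (iota \o v) (iota x) a.
Proof.
move=> hdim hnf; have [i0 _] := hI; have [hGr hGV] := hG.
have [t [Kt nt ht]] := krull_dim_one_nontrivial hV' hK hVK hVV' hdim.
have arch0 := krull_dim_one_archimedean hV' hK hVK hVV' hdim.
have [c [Kc nc hc]] := not_fundamental_bound hnf.
(* Torsion modulo the values of [L] becomes torsion modulo those of [K], as the extension is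
   immediate. *)
have tors b : b != 0 -> exists k c, [/\ (0 < k)%N, G c, c != 0 & veq W (b ^+ k) c].
  move=> /htors [k [e [k0 ne he]]]; have [e' [Ke' ne' hee']] := base_value ne.
  exists k, (iota e'); split=> //; [by exists e' | by rewrite fmorph_eq0 |].
  by apply: (veq_trans hW he); apply/(veq_map hWV').
have arch t' e : G t' -> 1 <!W t' -> G e -> e != 0 -> exists n, e <~W t' ^+ n.
  move=> [t1 Kt1 ->] h1 [e1 Ke1 ->]; rewrite fmorph_eq0 => ne1.
  have [|n hn] := arch0 t1 e1 Kt1 _ Ke1 ne1.
    by move=> h; apply: h1; rewrite -(rmorph1 iota); apply/(vle_map hWV').
  by exists n; rewrite -rmorphXn; apply/(vle_map hWV').
have Gt : G (iota t) by exists t.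
have ntE : iota t != 0 by rewrite fmorph_eq0.
have htE : 1 <!W iota t by rewrite -(rmorph1 iota) (vle_map hWV').
have Gc : G (iota c) by exists c.
have ncE : iota c != 0 by rewrite fmorph_eq0.
have hcE i : iota x - iota (v i) <~W iota c by rewrite -rmorphB; apply/(vle_map hWV').
have hF := vclosure_subfield hW hG tors Gt ntE htE.
have sub := @sub_vclosure E W G.
apply: (no_algebraic_limit (F := vclosure W G) (G := G) i0 hW hlim hinc) => //.
- by move=> r rs; exact: (vclosure_hensel hW hG tors arch Gt ntE htE).
- by move=> i; apply: sub; exists (v i).
- by move=> i; apply/hWV'; exact: hVV.
- exact/hWV'.
- move=> y hy hp; have [b Gb hb] := hy _ Gc ncE.
  apply: (base_no_plim Gb) => i.
  have -> : iota x - b = (iota x - y) + (y - b) by rewrite addrA subrK.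
  apply: vle_add => //; first exact: hp.
  by apply: (vle_trans hW) hb; exact: hcE.
- move=> s' hs'; set q := \prod_(b <- s') ('X - b%:P).
  (* The value of [q(v i)] is at most that of [c ^+ size s'] for large [i]; the factor [t], of
     positive value, makes the error strictly smaller than every such [q(v i)]. *)
  pose e := iota c ^+ size s' * iota t.
  have Ge : G e by apply: subringM => //; exact: subringX.
  have ne : e != 0 by rewrite mulf_neq0 ?expf_neq0.
  have hex k : exists b, G b /\ e <~W q`_k - b by have [b] := hs' k e Ge ne; exists b.
  have [g hg] := choice hex.
  exists (\poly_(k < size q) g k).
    by move=> k; rewrite coef_poly; case: ifP => _; [case: (hg k) | exact: subring0].
  apply: eventually_mono (root_behaviour_eventually i0 hW hlim hinc s') => i hi u Wu.
  have h1 : \prod_(b <- s') (iota (v i) - b) <~W iota c ^+ size s'.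
    have -> : iota c ^+ size s' = \prod_(b <- s') iota c.
      by rewrite big_const_seq count_predT iter_mulr_1.
    apply: vle_prod => // b hb _.
    apply: (vle_trans hW) (hcE i); apply: (root_behaviour_le_dist (v := iota \o v) hW); exact: hi.
  apply: (vle_lt_trans hW h1); apply: (vlt_le_trans hW (b := e)).
    by rewrite /e mulrC -{2}[_ ^+ _]mul1r (vle_pmul2r hW) // expf_neq0.
  rewrite -horner_prodXsub -/q horner_poly horner_coef -sumrB; apply: vle_sum => // k _.
  rewrite -mulrBl -[X in X <~W _]mulr1; apply: vle_mul => //.
    by apply: vle_subC => //; case: (hg k).
  by apply/(vring_ge1 hW); exact: subringX.
- exact: dominating_base_point.
have -> : \prod_(b <- s) ('X - b%:P) = (iota (lead_coef f))^-1 *: map_poly iota f.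
  by rewrite fs scalerA mulVf ?scale1r // fmorph_eq0 lead_coef_eq0.
move=> k; apply: sub; move: k.
apply: poly_overZ => //; last exact: poly_over_image.
by apply: hGV; exists (lead_coef f) => //; exact: hf.
Qed.
End AlgebraicCase.

Lemma transcendental_of_dominating_values :
  (forall y, K y -> ~ pseudo_limit V' v y) -> ~ fundamental K V v ->
  krull_dim_one V \/ henselian V ->
  (forall f : {poly L}, poly_over V f -> f.[x] != 0 -> exists y, V y /\ vle V' f.[x] f.[y]) ->
  transcendental_seq V v.
Proof.
move=> hnolim hnf hdim hP2 f hf; have [i0 _] := hI.
have hfK : poly_over K f by move=> k; exact: hVK.
have [f0|nf] := eqVneq f 0.
  by exists i0 => i i' _ _; rewrite f0 !horner0; split; left.
have [E [iota [W [s [hW hWV' tors fs]]]]] := splitting_valuation_extension hV' nf (leqnn _).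
have [|j hj] := value_stable_of_no_limit hW hWV' fs.
  move=> a; case: hdim => h.
    exact: (no_limit_dim_one hW hWV' tors hnolim hfK nf fs hP2 h hnf).
  exact: (no_limit_henselian hW hWV' hnolim hfK nf fs hP2 h).
by exists j => i i' hji hii'; apply/veq_base; try exact: poly_over_horner; exact: hj.
Qed.
End Immediate.

Theorem theorem3p2 (L : fieldType) (K V V' : L -> Prop)
  (d : Order.disp_t) (I : orderType d) (v : I -> L) (x : L)
  (hK : is_subfield K)
  (hV : is_valuation_ring_of K V)
  (hV' : is_valuation_ring_of (fun _ => True) V')
  (himm : immediate_extension K V V')
  (hwf : well_founded (fun i j : I => (i < j)%O))
  (hI : exists i : I, True)
  (hlim : forall i : I, exists j, (i < j)%O)
  (hvV : forall i, V (v i))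
  (hpc : pseudo_convergent V v)
  (hnf : ~ fundamental K V v)
  (hxV' : V' x)
  (hxlim : pseudo_limit V' v x)
  (hnolim : forall y, K y -> ~ pseudo_limit V' v y)
  (hKx : generated_by K x)
  (htr : transcendental_over K x)
  (hdim : krull_dim_one V \/ henselian V) :
  let P1 := forall f : {poly L}, poly_over V f -> f.[x] != 0 ->
              exists y, V y /\ veq V' f.[y] f.[x] in
  let P2 := forall f : {poly L}, poly_over V f -> f.[x] != 0 ->
              exists y, V y /\ vle V' f.[x] f.[y] in
  let P3 := transcendental_seq V v in
  let P4 := filtered_union_loc_poly V V' in
  (P1 <-> P2) /\ (P2 <-> P3) /\ (P3 <-> P4).
Proof.
move=> P1 P2 P3 P4.
have h12 : P1 -> P2 by move=> h f hf nf; have [y [Vy hy]] := h f hf nf; exists y; split=> //; case: hy.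
have h23 : P2 -> P3 by exact: (transcendental_of_dominating_values hK hV hV' himm hI hlim hvV hpc hxV' hxlim htr hnolim hnf hdim).
have h31 : P3 -> P1 by exact: (transcendental_values hK hV hV' himm hI hlim hvV hpc hxlim).
have h34 : P3 -> P4 by exact: (transcendental_filtered_union hK hV hV' himm hI hlim hvV hpc hxlim htr hKx).
have h41 : P4 -> P1 by exact: (filtered_union_values hK hV hV' himm hxV').
by split; [|split]; split; auto.
Qed.
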